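(* Let $k$, $G$, $V$ and $S=S(V)$ be as in the context, and let $G$ be abelian. Suppose $\kappa^L\in (H^2)^G$ is a linear cocycle with $[\kappa^L,\kappa^L]$ a coboundary. Then $[\kappa^L,\kappa^L]=0$ as a cochain. Thus $\mathcal{H}_\kappa$ is a Drinfeld orbifold algebra after setting $\kappa^C\equiv0$ and $\kappa:=\kappa^L$.
   Context: Setting: $k$ is a field of characteristic not $2$; $G$ is a finite group acting linearly (not necessarily faithfully) on a finite-dimensional $k$-vector space $V$; $|G|$ is invertible in $k$; and $k$ contains all eigenvalues of the actions of elements of $G$ on $V$. Write ${}^g v$ for the action, extended to $S=S(V)$ and $T(V)$ by automorphisms. For $A=S$ or $T(V)$, $A\# G=A\otimes kG$ with multiplication $(a g)(b h)=a\,({}^g b)\,gh$. Algebras. For a linear map $\kappa:V\wedge V\to(k\oplus V)\otimes kG$, with constant part $\kappa^C:V\wedge V\to kG$ and linear part $\kappa^L: V\wedge V\to V\otimes kG$, set $\mathcal{H}_\kappa=T(V)\# G/(vw-wv-\kappa(v,w)\mid v,w\in V)$, filtered by giving $v\in V$ degree $1$ and $g\in G$ degree $0$. $\mathcal{H}_\kappa$ is a Drinfeld orbifold algebra when its associated graded algebra is isomorphic (as a graded algebra) to $S\# G$ (the PBW condition). Cochains. $C^p=\bigoplus_{g\in G}C^p_g$ with $C^p_g=S g\otimes\bigwedge^p V^*$, identified with $\mathrm{Hom}_k(\bigwedge^pV,Sg)$; write $\alpha=\sum_g\alpha_g\,g$ with $\alpha_g:\bigwedge^pV\to S$. The differential is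 $(d^*\alpha)(v_1\wedge\cdots\wedge v_{p+1})=\sum_i(-1)^{i+1}\big(v_i\,\alpha(\cdots\hat v_i\cdots)-\alpha(\cdots\hat v_i\cdots)\,v_i\big)$ in $S\# G$ (dual to the Koszul resolution of $S$); cocycles and coboundaries are with respect to $d^*$. $G$ acts by $({}^h\alpha)(v_1\wedge\cdots\wedge v_p)={}^h\big(\alpha({}^{h^{-1}}v_1\wedge\cdots\wedge{}^{h^{-1}}v_p)\big)$ with ${}^h(sg)=({}^hs)\,hgh^{-1}$; a superscript $G$ denotes invariants. A cochain is linear if all its polynomial factors in $S$ are homogeneous of degree $1$; a linear $2$-cochain is a linear map $V\wedge V\to V\otimes kG$. Representatives. $V^g$ is the $g$-fixed subspace and $(V^g)^\perp$ its $g$-stable complement (the sum of the eigenspaces of $g$ with eigenvalue $\ne1$). Set $$H^p=\bigoplus_{g\in G}S(V^g)\,g\otimes\textstyle\bigwedge^{p-\mathrm{codim}V^g}(V^g)^*\otimes\bigwedge^{\mathrm{codim}V^g}((V^g)^\perp)^*\subset C^p,$$ with negative exterior powers zero. All elements of $H^p$ are cocycles. Cochain bracket. For linear $2$-cochains $\alpha,\beta$, $[\alpha,\beta]\in C^3$ is $$[\alpha,\beta](v_1,v_2,v_3)=\sum_{g,h\in G,\ \sigma\in\mathrm{Alt}_3}\Big[\alpha_{gh^{-1}}\big(\beta_h(v_{\sigma(1)}\wedge v_{\sigma(2)})\wedge v_{\sigma(3)}\big)+\beta_{gh^{-1}}\big(\alpha_h(v_{\sigma(1)}\wedge v_{\sigma(2)})\wedge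 v_{\sigma(3)}\big)\Big]g,$$ where $\mathrm{Alt}_3$ is the cyclic group of order $3$ in $\mathrm{Sym}_3$. *)

(* Defs.v *)
From HB Require Import structures.
From mathcomp Require Import all_boot all_order all_fingroup all_algebra all_solvable.
From mathcomp Require Import boolp.
From mathcomp Require Import finmap.
From mathcomp Require Import monalg mpoly.
Set Implicit Arguments.
Unset Strict Implicit.
Unset Printing Implicit Defensive.

Import GRing.Theory.
Local Open Scope ring_scope.

(* Submodules are Prop-valued; quotients by them are formed classically. *)
Record submod (R : pzRingType) (V : lmodType R) := Submod {
  submod_mem :> V -> Prop;
  submod_mem0 : submod_mem 0;
  submod_memL : forall a x y,
    submod_mem x -> submod_mem y -> submod_mem (a *: x + y)
}.

Section SubQuot.
Context {R : pzRingType} {V : lmodType R} (U : submod V).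

Definition submod_pred : pred V := fun x => `[< U x >].

Fact submod_pred_closed : submod_closed submod_pred.
Proof.
split=> [|a x y]; first exact/asboolP/submod_mem0.
by move=> /asboolP Ux /asboolP Uy; apply/asboolP/submod_memL.
Qed.
HB.instance Definition _ :=
  GRing.isSubmodClosed.Build R V submod_pred submod_pred_closed.

Definition submod_zmod : zmodClosed V := GRing.ZmodClosed.clone V submod_pred _.

Record submod_type := SubmodElt {
  submod_val :> V;
  submod_valP : submod_val \in submod_pred }.

HB.instance Definition _ := [isSub for submod_val].
HB.instance Definition _ := [Choice of submod_type by <:].
HB.instance Definition _ := [SubChoice_isSubLmodule of submod_type by <:].

Definition quotmod := {ideal_quot submod_zmod}.
HB.instance Definition _ := GRing.Zmodule.on quotmod.

Definition qclass (x : V) : quotmod := \pi_({ideal_quot submod_zmod})%qT x.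

Lemma qclass_eq x y : qclass x = qclass y <-> U (x - y).
Proof.
split; last first.
- by move=> Uxy; apply/eqP; rewrite -Quotient.idealrBE; apply/asboolP.
by move/eqP; rewrite -Quotient.idealrBE => /asboolP.
Qed.

Lemma qclassK (x : quotmod) :
  qclass (generic_quotient.repr (x : {ideal_quot submod_zmod})) = x.
Proof. exact: reprK. Qed.

Lemma qclassD x y : qclass (x + y) = qclass x + qclass y.
Proof. by rewrite /qclass raddfD. Qed.

Definition quotmod_scale (a : R) (x : quotmod) : quotmod :=
  qclass (a *: generic_quotient.repr (x : {ideal_quot submod_zmod})).

Lemma quotmod_scaleE a x : quotmod_scale a (qclass x) = qclass (a *: x).
Proof.
apply/qclass_eq; rewrite -scalerBr.
have /qclass_eq := qclassK (qclass x).
move=> Ux; rewrite -[_ *: _]addr0; apply: submod_memL => //; exact: submod_mem0.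
Qed.

Fact quotmod_scaleA a b x :
  quotmod_scale a (quotmod_scale b x) = quotmod_scale (a * b) x.
Proof. by rewrite -[x]qclassK !quotmod_scaleE scalerA. Qed.
Fact quotmod_scale1 : left_id 1 quotmod_scale.
Proof. by move=> x; rewrite -[x]qclassK quotmod_scaleE scale1r. Qed.
Fact quotmod_scaleDr : right_distributive quotmod_scale +%R.
Proof.
move=> a x y; rewrite -[x]qclassK -[y]qclassK.
by rewrite -qclassD !quotmod_scaleE -qclassD scalerDr.
Qed.
Fact quotmod_scaleDl x : {morph quotmod_scale^~ x : a b / a + b}.
Proof. by move=> a b; rewrite -[x]qclassK !quotmod_scaleE -qclassD scalerDl. Qed.
HB.instance Definition _ := GRing.Zmodule_isLmodule.Build R quotmod
  quotmod_scaleA quotmod_scale1 quotmod_scaleDr quotmod_scaleDl.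

Fact qclass_is_linear : linear qclass.
Proof. by move=> a x y; rewrite qclassD -quotmod_scaleE. Qed.
HB.instance Definition _ :=
  GRing.isLinear.Build R V quotmod _ qclass qclass_is_linear.

End SubQuot.

(* Two-sided ideals; they need not be proper, so a quotient by one may be the
   zero ring, whence only a pzRingType on quotalg. *)
Record ideal2 (k : fieldType) (A : algType k) := Ideal2 {
  ideal2_submod :> submod A;
  ideal2Ml : forall a x, ideal2_submod x -> ideal2_submod (a * x);
  ideal2Mr : forall a x, ideal2_submod x -> ideal2_submod (x * a)
}.

Section QuotAlg.
Context {k : fieldType} {A : algType k} (I : ideal2 A).

Definition quotalg := quotmod I.
HB.instance Definition _ := GRing.Lmodule.on quotalg.

Definition aclass (x : A) : quotalg := qclass I x.
Fact aclass_is_linear : linear aclass. Proof. exact: linearP. Qed.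
HB.instance Definition _ :=
  GRing.isLinear.Build k A quotalg _ aclass aclass_is_linear.

Definition arepr (x : quotalg) : A :=
  generic_quotient.repr (x : {ideal_quot submod_zmod I}).

Lemma areprK x : aclass (arepr x) = x. Proof. exact: qclassK. Qed.

Lemma aclass_eq x y : aclass x = aclass y <-> I (x - y).
Proof. exact: qclass_eq. Qed.

Definition quotalg_one : quotalg := aclass 1.
Definition quotalg_mul (x y : quotalg) : quotalg := aclass (arepr x * arepr y).

Lemma quotalg_mulE x y : quotalg_mul (aclass x) (aclass y) = aclass (x * y).
Proof.
apply/aclass_eq; set x' := arepr _; set y' := arepr _.
have Ix : I (x' - x) by apply/aclass_eq; exact: areprK.
have Iy : I (y' - y) by apply/aclass_eq; exact: areprK.
have -> : x' * y' - x * y = 1 *: (x' * (y' - y)) + (x' - x) * y.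
  by rewrite scale1r mulrBr mulrBl addrA subrK.
by apply: submod_memL; [exact: ideal2Ml|exact: ideal2Mr].
Qed.

Fact quotalg_mulA : associative quotalg_mul.
Proof.
move=> x y z; rewrite -[x]areprK -[y]areprK -[z]areprK.
by rewrite !quotalg_mulE mulrA.
Qed.
Fact quotalg_mul1x : left_id quotalg_one quotalg_mul.
Proof. by move=> x; rewrite -[x]areprK quotalg_mulE mul1r. Qed.
Fact quotalg_mulx1 : right_id quotalg_one quotalg_mul.
Proof. by move=> x; rewrite -[x]areprK quotalg_mulE mulr1. Qed.
Fact quotalg_mulDl : left_distributive quotalg_mul +%R.
Proof.
move=> x y z; rewrite -[x]areprK -[y]areprK -[z]areprK.
by rewrite -raddfD !quotalg_mulE -raddfD mulrDl.
Qed.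
Fact quotalg_mulDr : right_distributive quotalg_mul +%R.
Proof.
move=> x y z; rewrite -[x]areprK -[y]areprK -[z]areprK.
by rewrite -raddfD !quotalg_mulE -raddfD mulrDr.
Qed.
HB.instance Definition _ := GRing.Zmodule_isPzRing.Build quotalg
  quotalg_mulA quotalg_mul1x quotalg_mulx1 quotalg_mulDl quotalg_mulDr.

Fact aclass_is_monoid_morphism : monoid_morphism aclass.
Proof. by split=> // x y; rewrite -[LHS]quotalg_mulE. Qed.
HB.instance Definition _ :=
  GRing.isMonoidMorphism.Build A quotalg aclass aclass_is_monoid_morphism.

Lemma quotalg_scaleAl a (x y : quotalg) : a *: (x * y) = (a *: x) * y.
Proof.
rewrite -[x]areprK -[y]areprK -rmorphM -[in RHS]linearZ -rmorphM -linearZ.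
by rewrite scalerAl.
Qed.

Lemma quotalg_scaleAr a (x y : quotalg) : a *: (x * y) = x * (a *: y).
Proof.
rewrite -[x]areprK -[y]areprK -rmorphM -[in RHS]linearZ -rmorphM -linearZ.
by rewrite scalerAr.
Qed.

End QuotAlg.

Section IdealGen.
Context {k : fieldType} {A : algType k} (X : A -> Prop).

Definition ideal_gen_mem (x : A) : Prop :=
  forall J : ideal2 A, (forall y, X y -> J y) -> J x.

Fact ideal_gen_mem0 : ideal_gen_mem 0.
Proof. by move=> J _; exact: submod_mem0. Qed.
Fact ideal_gen_memL a x y :
  ideal_gen_mem x -> ideal_gen_mem y -> ideal_gen_mem (a *: x + y).
Proof. by move=> Ix Iy J XJ; apply: submod_memL; [exact: Ix|exact: Iy]. Qed.
Fact ideal_genMl a x : ideal_gen_mem x -> ideal_gen_mem (a * x).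
Proof. by move=> Ix J XJ; apply: ideal2Ml; exact: Ix. Qed.
Fact ideal_genMr a x : ideal_gen_mem x -> ideal_gen_mem (x * a).
Proof. by move=> Ix J XJ; apply: ideal2Mr; exact: Ix. Qed.

Definition ideal_gen : ideal2 A :=
  @Ideal2 k A (Submod ideal_gen_mem0 ideal_gen_memL) ideal_genMl ideal_genMr.

Lemma mem_ideal_gen x : X x -> ideal_gen x.
Proof. by move=> Xx J; apply. Qed.

End IdealGen.

(* An N-graded algebra is given by its homogeneous components, its unit and its
   products A_i x A_j -> A_(i+j).  An isomorphism of graded algebras is then a
   family of linear bijections compatible with the unit and the products. *)
Record graded_alg (k : fieldType) := GradedAlg {
  gpiece :> nat -> lmodType k;
  gone : gpiece 0;
  gmul : forall i j, gpiece i -> gpiece j -> gpiece (i + j)%N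
}.

Definition graded_iso (k : fieldType) (A B : graded_alg k) : Prop :=
  exists phi : forall d, {linear A d -> B d},
    [/\ forall d, bijective (phi d),
        phi 0%N (gone A) = gone B
      & forall i j (x : A i) (y : A j),
          phi (i + j)%N (gmul x y) = gmul (phi i x) (phi j y)].

Record filtration (k : fieldType) (A : algType k) := Filtration {
  fil :> nat -> submod A;
  fil_mono : forall d x, fil d x -> fil d.+1 x;
  fil1 : fil 0 1;
  filM : forall i j x y, fil i x -> fil j y -> fil (i + j)%N (x * y)
}.

Record grading (k : fieldType) (A : algType k) := Grading {
  ghom :> nat -> submod A;
  ghom1 : ghom 0 1;
  ghomM : forall i j x y, ghom i x -> ghom j y -> ghom (i + j)%N (x * y)
}.

Section GradedOf.
Context {k : fieldType} {A : algType k} (D : grading A).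

Definition hpiece d : lmodType k := submod_type (D d).

Lemma submod_type_mem (V : lmodType k) (U : submod V) (x : submod_type U) :
  U (val x).
Proof. exact/asboolP/submod_valP. Qed.

Definition submod_elt (V : lmodType k) (U : submod V) (x : V) (Ux : U x) :
  submod_type U := SubmodElt (introT (asboolP _) Ux).

Definition graded_of : graded_alg k :=
  @GradedAlg k hpiece (submod_elt (ghom1 D))
    (fun i j x y => submod_elt (ghomM (submod_type_mem x) (submod_type_mem y))).

End GradedOf.

(* The algebra A/I with the filtration induced by F (the images of the F_d), and
   its associated graded algebra, with components F_d(A/I) / F_(d-1)(A/I),
   where F_(-1) = 0. *)
Section AssociatedGraded.
Context {k : fieldType} {A : algType k} (F : filtration A) (I : ideal2 A).

Definition qfil_mem d (y : quotalg I) : Prop := exists2 x, F d x & y = aclass I x.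

Fact qfil_mem0 d : qfil_mem d 0.
Proof. by exists 0; [exact: submod_mem0|rewrite raddf0]. Qed.
Fact qfil_memL d a x y :
  qfil_mem d x -> qfil_mem d y -> qfil_mem d (a *: x + y).
Proof.
move=> [x' Fx ->] [y' Fy ->]; exists (a *: x' + y'); first exact: submod_memL.
by rewrite linearP.
Qed.
Definition qfil d : submod (quotalg I) := Submod (@qfil_mem0 d) (@qfil_memL d).

Fact qfil1 : qfil 0 1. Proof. by exists 1 => //; exact: fil1. Qed.
Fact qfilM i j x y : qfil i x -> qfil j y -> qfil (i + j)%N (x * y).
Proof.
move=> [x' Fx ->] [y' Fy ->]; exists (x' * y'); first exact: filM.
by rewrite rmorphM.
Qed.
Fact qfil_mono d x : qfil d x -> qfil d.+1 x.
Proof. by move=> [x' Fx ->]; exists x' => //; exact: fil_mono. Qed.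

Definition qfil_pred_mem d (x : quotalg I) : Prop :=
  if d is d'.+1 then qfil d' x else x = 0.

Fact qfil_pred_mem0 d : @qfil_pred_mem d (val (0 : submod_type (qfil d))).
Proof. by rewrite raddf0; case: d => //= d; exact: qfil_mem0. Qed.
Fact qfil_pred_memL d a (x y : submod_type (qfil d)) :
  qfil_pred_mem d (val x) -> qfil_pred_mem d (val y) ->
  qfil_pred_mem d (val (a *: x + y)).
Proof.
case: d x y => [|d] x y; rewrite linearP /=; last exact: qfil_memL.
by move=> -> ->; rewrite scaler0 addr0.
Qed.
Definition qfil_pred d : submod (submod_type (qfil d)) :=
  @Submod k _ (fun x => qfil_pred_mem d (val x))
     (@qfil_pred_mem0 d) (@qfil_pred_memL d).

Definition gr_piece d : lmodType k := quotmod (qfil_pred d).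

Definition gr_class d (x : quotalg I) (Fx : qfil d x) : gr_piece d :=
  qclass (qfil_pred d) (submod_elt Fx).

Definition gr_repr d (x : gr_piece d) : submod_type (qfil d) :=
  generic_quotient.repr (x : {ideal_quot submod_zmod (qfil_pred d)}).

Definition gr_one : gr_piece 0 := gr_class qfil1.
Definition gr_mul i j (x : gr_piece i) (y : gr_piece j) : gr_piece (i + j)%N :=
  gr_class (qfilM (submod_type_mem (gr_repr x)) (submod_type_mem (gr_repr y))).

Definition gr : graded_alg k := GradedAlg gr_one gr_mul.

Lemma gr_mulE i j x y (Fx : qfil i x) (Fy : qfil j y) :
  gr_mul (gr_class Fx) (gr_class Fy) = gr_class (qfilM Fx Fy).
Proof.
apply/qclass_eq => /=; set x' := gr_repr _; set y' := gr_repr _.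
have Fx' := submod_type_mem x'.
have : qfil_pred_mem i (val x' - x).
  rewrite -[x]/(val (submod_elt Fx)) -raddfB.
  by apply/(qclass_eq (qfil_pred i)); exact: qclassK.
have : qfil_pred_mem j (val y' - y).
  rewrite -[y]/(val (submod_elt Fy)) -raddfB.
  by apply/(qclass_eq (qfil_pred j)); exact: qclassK.
move=> Fdy Fdx.
suff : qfil_pred_mem (i + j) (val x' * val y' - x * y) by [].
move: (val x') (val y') Fx' Fdy Fdx => {x' y'} x' y' Fx'.
set dy := _ - y; set dx := _ - x => Fdy Fdx.
have -> : x' * y' - x * y = x' * dy + dx * y.
  by rewrite mulrBr mulrBl addrA subrK.
clearbody dx dy; clear y' Fx.
case: j Fy Fdy => [|j] Fy Fdy.
- rewrite Fdy mulr0 add0r; case: i Fx' Fdx => [|i] Fx' Fdx.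
  + by rewrite addn0 Fdx mul0r.
  + by rewrite addSn; apply: qfilM.
rewrite addnS -[X in X + _]scale1r.
apply: qfil_memL; first exact: qfilM.
case: i Fx' Fdx => [|i] Fx' Fdx.
+ by rewrite Fdx mul0r; exact: qfil_mem0.
+ by rewrite addSnnS; exact: qfilM.
Qed.

End AssociatedGraded.

Record gaction (gT : finGroupType) (k : fieldType) (A : algType k) := GAction {
  gact :> gT -> {lrmorphism A -> A};
  gact1 : gact 1%g =1 id;
  gactM : forall g h, gact (g * h)%g =1 gact g \o gact h
}.

(* The skew group algebra A # G: x g is the coefficient in A of the group element
   g, so that x = \sum_g (x g) g, and (a g)(b h) = a (g.b) gh. *)
Section Skew.
Context {gT : finGroupType} {k : fieldType} {A : algType k}.

Definition skewalg (act : gaction gT A) : Type := {ffun gT -> A}.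

Variable act : gaction gT A.
Local Notation skew := (skewalg act).

HB.instance Definition _ := GRing.Lmodule.on skew.

Definition skew_fun (x : skew) : gT -> A := fun g => (x : {ffun gT -> A}) g.
Coercion skew_fun : skew >-> Funclass.

Definition skew_of (f : gT -> A) : skew := [ffun g => f g].

Lemma skew_ofE f g : skew_of f g = f g. Proof. exact: ffunE. Qed.

Lemma skewP (x y : skew) : (forall g, x g = y g) -> x = y.
Proof. by move=> xy; apply/ffunP. Qed.

Lemma skewDE (x y : skew) g : skew_fun (x + y) g = x g + y g.
Proof. exact: ffunE. Qed.

Lemma skewZE a (x : skew) g : skew_fun (a *: x) g = a *: x g.
Proof. exact: ffunE. Qed.

Definition skew_elt (a : A) (g : gT) : skew :=
  skew_of (fun h => if h == g then a else 0).

Definition skew_one : skew := skew_elt 1 1%g.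

Definition skew_mul (x y : skew) : skew :=
  skew_of (fun g => \sum_h x h * act h (y (h^-1 * g)%g)).

Fact skew_mulA : associative skew_mul.
Proof.
move=> x y z; apply: skewP => g; rewrite !skew_ofE.
under eq_bigr do rewrite skew_ofE raddf_sum mulr_sumr.
under [RHS]eq_bigr do rewrite skew_ofE mulr_suml.
rewrite [RHS]exchange_big; apply: eq_bigr => h _.
rewrite [RHS](reindex_inj (mulgI h)); apply: eq_bigr => u _.
by rewrite /= mulKg rmorphM mulrA gactM /= invMg mulgA.
Qed.
Fact skew_mul1x : left_id skew_one skew_mul.
Proof.
move=> x; apply: skewP => g; rewrite skew_ofE (bigD1 1%g) //= big1 ?addr0.
  by rewrite skew_ofE eqxx mul1r gact1 invg1 mul1g.
by move=> h /negPf h1; rewrite skew_ofE h1 mul0r.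
Qed.
Fact skew_mulx1 : right_id skew_one skew_mul.
Proof.
move=> x; apply: skewP => g; rewrite skew_ofE (bigD1 g) //= big1 ?addr0.
  by rewrite mulVg skew_ofE eqxx rmorph1 mulr1.
move=> h hg; rewrite skew_ofE -eq_mulVg1 (negPf hg) raddf0 mulr0 //.
Qed.
Fact skew_mulDl : left_distributive skew_mul +%R.
Proof.
move=> x y z; apply: skewP => g; rewrite skewDE !skew_ofE -big_split.
by apply: eq_bigr => h _; rewrite skewDE mulrDl.
Qed.
Fact skew_mulDr : right_distributive skew_mul +%R.
Proof.
move=> x y z; apply: skewP => g; rewrite skewDE !skew_ofE -big_split.
by apply: eq_bigr => h _; rewrite skewDE raddfD mulrDr.
Qed.
Fact skew_1neq0 : skew_one != 0.
Proof.
apply/eqP => /(congr1 (fun x : skew => x 1%g)) /eqP.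
by rewrite skew_ofE eqxx /skew_fun ffunE oner_eq0.
Qed.
HB.instance Definition _ := GRing.Zmodule_isNzRing.Build skew
  skew_mulA skew_mul1x skew_mulx1 skew_mulDl skew_mulDr skew_1neq0.

Lemma skewME (x y : skew) g :
  skew_fun (x * y) g = \sum_h x h * act h (y (h^-1 * g)%g).
Proof. exact: skew_ofE. Qed.

Fact skew_scaleAl a (x y : skew) : a *: (x * y) = (a *: x) * y.
Proof.
apply: skewP => g; rewrite skewZE !skewME scaler_sumr.
by apply: eq_bigr => h _; rewrite skewZE scalerAl.
Qed.
HB.instance Definition _ := GRing.Lmodule_isLalgebra.Build k skew skew_scaleAl.

Fact skew_scaleAr a (x y : skew) : a *: (x * y) = x * (a *: y).
Proof.
apply: skewP => g; rewrite skewZE !skewME scaler_sumr.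
by apply: eq_bigr => h _; rewrite skewZE linearZ scalerAr.
Qed.
HB.instance Definition _ := GRing.Lalgebra_isAlgebra.Build k skew skew_scaleAr.

Section CoefSubmod.
Variable U : submod A.
Definition skew_coef_mem (x : skew) : Prop := forall g, U (x g).
Fact skew_coef_mem0 : skew_coef_mem 0.
Proof. by move=> g; rewrite /skew_fun ffunE; exact: submod_mem0. Qed.
Fact skew_coef_memL a x y :
  skew_coef_mem x -> skew_coef_mem y -> skew_coef_mem (a *: x + y).
Proof. by move=> Ux Uy g; rewrite skewDE skewZE; apply: submod_memL. Qed.
Definition skew_coef : submod skew := Submod skew_coef_mem0 skew_coef_memL.
End CoefSubmod.

Lemma skew_elt_coef (U : submod A) a g : U a -> skew_coef U (skew_elt a g).
Proof. by move=> Ua h; rewrite skew_ofE; case: ifP => // _; exact: submod_mem0. Qed.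

Lemma submod_sum (V : lmodType k) (U : submod V) (J : finType) (f : J -> V) :
  (forall j, U (f j)) -> U (\sum_j f j).
Proof.
move=> Uf; apply: big_ind => //; first exact: submod_mem0.
by move=> x y Ux Uy; rewrite -[x]scale1r; apply: submod_memL.
Qed.

Lemma skew_coefM (U W Z : submod A) x y :
    (forall a b, U a -> W b -> Z (a * b)) -> (forall g b, W b -> W (act g b)) ->
  skew_coef U x -> skew_coef W y -> skew_coef Z (x * y).
Proof.
move=> UWZ actW Ux Wy g; rewrite skewME; apply: submod_sum => h.
by apply: UWZ; [exact: Ux|apply: actW; exact: Wy].
Qed.

Definition skew_filtration (F : filtration A)
  (actF : forall d g a, F d a -> F d (act g a)) : filtration skew :=
  @Filtration k skew (fun d => skew_coef (F d))
    (fun d x Fx g => fil_mono (Fx g)) (skew_elt_coef 1%g (fil1 F))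
    (fun i j x y => skew_coefM (@filM _ _ F i j) (@actF j)).

Definition skew_grading (D : grading A)
  (actD : forall d g a, D d a -> D d (act g a)) : grading skew :=
  @Grading k skew (fun d => skew_coef (D d)) (skew_elt_coef 1%g (ghom1 D))
    (fun i j x y => skew_coefM (@ghomM _ _ D i j) (@actD j)).

End Skew.

Record linrep (gT : finGroupType) (k : fieldType) (V : vectType k) := LinRep {
  lrep :> gT -> 'End(V);
  lrep1 : lrep 1%g = \1%VF;
  lrepM : forall g h, lrep (g * h)%g = (lrep g \o lrep h)%VF
}.

Lemma malg_scalerAr (k : fieldType) (K : monomType) a (x y : {malg k[K]}) :
  a *: (x * y) = x * (a *: y).
Proof.
apply/malgP => m; rewrite monalg.mcoeffZ.
rewrite (mcoeffMlw m (fsubset_refl _) (monalg.msuppZ_le a y)) monalg.mcoeffMl.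
rewrite mulr_sumr; apply: eq_bigr => m1 _; rewrite mulr_sumr.
by apply: eq_bigr => m2 _; rewrite monalg.mcoeffZ mulrnAr mulrCA.
Qed.

Lemma malgU_scale (k : fieldType) (K : monomType) (c : k) (m : K) :
  << c *g m >> = c *: << m >> :> {malg k[K]}.
Proof.
by apply/malgP => l; rewrite monalg.mcoeffZ !monalg.mcoeffU mulrnAr mulr1.
Qed.

(* T(V) is the free algebra, and S(V) the polynomial algebra, on the basis
   vbasis {:V} of V; tenv and symv are the canonical embeddings of V. *)
Section TensorSymmetric.
Context {k : fieldType} (V : vectType k).
Local Notation n := (\dim {:V}).

Definition vcoord (i : 'I_n) (v : V) : k := coord (vbasis {:V}) i v.
Definition vbase (i : 'I_n) : V := (vbasis {:V})`_i.

Lemma vcoordE v : v = \sum_i vcoord i v *: vbase i.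
Proof. by apply: coord_vbasis; exact: memvf. Qed.

Definition symalg : Type := mpoly n k.
HB.instance Definition _ := GRing.ComAlgebra.on symalg.

Definition tenalg : Type := {malg k[{fmonom 'I_n}]}.
HB.instance Definition _ := GRing.Lalgebra.on tenalg.

HB.instance Definition _ :=
  GRing.Lalgebra_isAlgebra.Build k tenalg (@malg_scalerAr _ _).

Definition symX (i : 'I_n) : symalg := mpolyX k U_(i)%MM.
Definition tenX (i : 'I_n) : tenalg := << fmu i >>.

Definition symv (v : V) : symalg := \sum_i vcoord i v *: symX i.
Definition tenv (v : V) : tenalg := \sum_i vcoord i v *: tenX i.

Fact symv_is_linear : linear symv.
Proof.
move=> a u v; rewrite scaler_sumr -big_split; apply: eq_bigr => i _.
by rewrite /vcoord linearP scalerDl scalerA.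
Qed.
HB.instance Definition _ := GRing.isLinear.Build k V symalg _ symv symv_is_linear.

Fact tenv_is_linear : linear tenv.
Proof.
move=> a u v; rewrite scaler_sumr -big_split; apply: eq_bigr => i _.
by rewrite /vcoord linearP scalerDl scalerA.
Qed.
HB.instance Definition _ := GRing.isLinear.Build k V tenalg _ tenv tenv_is_linear.

Lemma vcoord_base i j : vcoord i (vbase j) = (j == i)%:R.
Proof. by apply: coord_free; exact: (basis_free (vbasisP _)). Qed.

Lemma symv_base i : symv (vbase i) = symX i.
Proof.
rewrite /symv (bigD1 i) //= vcoord_base eqxx scale1r big1 ?addr0 // => j ji.
by rewrite vcoord_base eq_sym (negPf ji) scale0r.
Qed.

Lemma tenv_base i : tenv (vbase i) = tenX i.
Proof.
rewrite /tenv (bigD1 i) //= vcoord_base eqxx scale1r big1 ?addr0 // => j ji.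
by rewrite vcoord_base eq_sym (negPf ji) scale0r.
Qed.

Definition symlift (f : {linear V -> symalg}) : symalg -> symalg :=
  comp_mpoly [tuple f (vbase i) | i < n].
HB.instance Definition _ f := GRing.LRMorphism.on (symlift f).
Lemma symliftv f v : symlift f (symv v) = f v.
Proof.
rewrite [in RHS](vcoordE v) !raddf_sum; apply: eq_bigr => i _ /=.
by rewrite !linearZ /= /symlift comp_mpolyXU -tnth_nth tnth_mktuple.
Qed.

Lemma symalg_ext (B : lalgType k) (f g : {lrmorphism symalg -> B}) :
  (forall v, f (symv v) = g (symv v)) -> f =1 g.
Proof.
move=> fg p; rewrite (mpolyE p) !raddf_sum; apply: eq_bigr => m _ /=.
rewrite !linearZ /=; congr (_ *: _); rewrite mpolyXE_id !rmorph_prod.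
apply: eq_bigr => i _; rewrite !rmorphXn; congr (_ ^+ _).
by have := fg (vbase i); rewrite symv_base.
Qed.

Section TenLift.
Context {B : algType k} (f : {linear V -> B}).

Definition tenlift_word (m : {fmonom 'I_n}) : B :=
  \prod_(i <- fmonom_val m) f (vbase i).

Fact tenlift_word_mmorphism : mmorphism tenlift_word.
Proof.
by split=> [m1 m2|]; rewrite /tenlift_word ?fmM ?big_cat // fm1 big_nil.
Qed.
HB.instance Definition _ :=
  isMultiplicative.Build {fmonom 'I_n} B tenlift_word tenlift_word_mmorphism.

Definition tenlift (x : tenalg) : B := monalg.mmap (in_alg B) tenlift_word x.

Fact tenlift_is_zmod : zmod_morphism tenlift.
Proof. exact: monalg.mmap_is_additive. Qed.
HB.instance Definition _ :=
  GRing.isZmodMorphism.Build tenalg B tenlift tenlift_is_zmod.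

Fact tenlift_is_monoid : monoid_morphism tenlift.
Proof.
have comm (g : {malg k[{fmonom 'I_n}]}) m m' :
    GRing.comm (in_alg B (monalg.mcoeff m g)) (tenlift_word m').
  by rewrite /GRing.comm /= mulr_algl mulr_algr.
have [tM t1] := monalg.commr_mmap_is_multiplicative comm.
by split.
Qed.
HB.instance Definition _ :=
  GRing.isMonoidMorphism.Build tenalg B tenlift tenlift_is_monoid.

Fact tenlift_is_scalable : scalable tenlift.
Proof. by move=> a x; rewrite /tenlift monalg.mmapZ /= mulr_algl. Qed.
HB.instance Definition _ :=
  GRing.isScalable.Build k tenalg B _ tenlift tenlift_is_scalable.

Lemma tenlift_base i : tenlift (tenX i) = f (vbase i).
Proof.
rewrite /tenlift monalg.mmapU /= scale1r mul1r /tenlift_word fmU.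
by rewrite big_seq1.
Qed.

Lemma tenliftv v : tenlift (tenv v) = f v.
Proof.
rewrite [in RHS](vcoordE v) !raddf_sum; apply: eq_bigr => i _ /=.
by rewrite !linearZ /= tenlift_base.
Qed.

End TenLift.

Lemma tenX_prod (m : {fmonom 'I_n}) :
  \prod_(i <- fmonom_val m) tenX i = << m >> :> tenalg.
Proof.
case: m => s /=; elim: s => [|i s IHs].
  by rewrite big_nil -fmoneE.
rewrite big_cons IHs -[LHS]/(fgmul _ _) fgmulUU mulr1.
by congr << _ >>; apply/val_inj; rewrite /= fmM fmU.
Qed.

Lemma tenalg_ext (B : lalgType k) (f g : {lrmorphism tenalg -> B}) :
  (forall v, f (tenv v) = g (tenv v)) -> f =1 g.
Proof.
move=> fg x; rewrite [x]monalgE !raddf_sum; apply: eq_bigr => m _ /=.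
have -> : << monalg.mcoeff m x *g m >>
        = monalg.mcoeff m x *: (\prod_(i <- fmonom_val m) tenX i : tenalg).
  by rewrite tenX_prod; exact: malgU_scale.
rewrite !linearZ /= !rmorph_prod; congr (_ *: _); apply: eq_bigr => i _.
by have := fg (vbase i); rewrite tenv_base.
Qed.

End TensorSymmetric.

Arguments symv {k V} v.
Arguments tenv {k V} v.
Arguments vbase {k V} i.
Arguments vcoord {k V} i v.
Arguments symX {k V} i.
Arguments tenX {k V} i.

Section Actions.
Context {gT : finGroupType} {k : fieldType} {V : vectType k}.
Variable rho : linrep gT V.
Local Notation n := (\dim {:V}).

Definition sym_act (g : gT) : {lrmorphism symalg V -> symalg V} :=
  symlift (symv \o rho g).

Lemma sym_actv g v : sym_act g (symv v) = symv (rho g v).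
Proof. exact: symliftv. Qed.

Fact sym_act1 : sym_act 1%g =1 id.
Proof.
by apply: (symalg_ext (g := idfun)) => v; rewrite sym_actv lrep1 lfunE.
Qed.
Fact sym_actM g h : sym_act (g * h)%g =1 sym_act g \o sym_act h.
Proof.
apply: (symalg_ext (g := sym_act g \o sym_act h)) => v.
by rewrite [RHS]/= !sym_actv lrepM lfunE.
Qed.
Definition sym_gaction : gaction gT (symalg V) := GAction sym_act1 sym_actM.

Definition ten_act (g : gT) : {lrmorphism tenalg V -> tenalg V} :=
  tenlift (tenv \o rho g).

Lemma ten_actv g v : ten_act g (tenv v) = tenv (rho g v).
Proof. exact: tenliftv. Qed.

Fact ten_act1 : ten_act 1%g =1 id.
Proof.
by apply: (tenalg_ext (g := idfun)) => v; rewrite ten_actv lrep1 lfunE.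
Qed.
Fact ten_actM g h : ten_act (g * h)%g =1 ten_act g \o ten_act h.
Proof.
apply: (tenalg_ext (g := ten_act g \o ten_act h)) => v.
have gh : rho (g * h)%g v = rho g (rho h v) by rewrite lrepM lfunE.
apply: (etrans (ten_actv (g * h)%g v)); rewrite gh; apply: esym.
exact: (etrans (congr1 (ten_act g) (ten_actv h v)) (ten_actv g (rho h v))).
Qed.
Definition ten_gaction : gaction gT (tenalg V) := GAction ten_act1 ten_actM.

Definition symskew : algType k := skewalg sym_gaction.
Definition tenskew : algType k := skewalg ten_gaction.
End Actions.

Section Degrees.
Context {k : fieldType} (V : vectType k).
Local Notation n := (\dim {:V}).

Definition sym_hom_mem (d : nat) (p : symalg V) : Prop :=
  (p : mpoly n k) \is d.-homog.
Fact sym_hom0 d : sym_hom_mem d 0. Proof. exact: dhomog0. Qed.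
Fact sym_homL d a x y :
  sym_hom_mem d x -> sym_hom_mem d y -> sym_hom_mem d (a *: x + y).
Proof. by move=> hx hy; apply: dhomogD => //; apply: dhomogZ. Qed.
Definition sym_hom d : submod (symalg V) := Submod (@sym_hom0 d) (@sym_homL d).
Fact sym_hom1 : sym_hom 0 1. Proof. exact: dhomog1. Qed.
Fact sym_homM i j x y : sym_hom i x -> sym_hom j y -> sym_hom (i + j)%N (x * y).
Proof. exact: dhomogM. Qed.
Definition sym_grading : grading (symalg V) := Grading sym_hom1 sym_homM.

Definition ten_fil_mem (d : nat) (x : tenalg V) : Prop :=
  forall m : {fmonom 'I_n}, (d < fdeg m)%N -> monalg.mcoeff m x = 0.
Fact ten_fil0 d : ten_fil_mem d 0.
Proof. by move=> m _; exact: monalg.mcoeff0. Qed.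
Fact ten_filL d a x y :
  ten_fil_mem d x -> ten_fil_mem d y -> ten_fil_mem d (a *: x + y).
Proof.
move=> hx hy m dm.
by rewrite monalg.mcoeffD monalg.mcoeffZ hx // hy // mulr0 addr0.
Qed.
Definition ten_fil d : submod (tenalg V) := Submod (@ten_fil0 d) (@ten_filL d).
Fact ten_fil_mono d x : ten_fil d x -> ten_fil d.+1 x.
Proof. by move=> hx m /ltnW; exact: hx. Qed.
Fact ten_fil1 : ten_fil 0 1.
Proof.
move=> m; rewrite monalg.mcoeff1; case: eqP => // ->.
by rewrite fdeg1.
Qed.
Fact ten_filM i j x y : ten_fil i x -> ten_fil j y -> ten_fil (i + j)%N (x * y).
Proof.
move=> hx hy m ijm; rewrite monalg.mcoeffMl big1 // => m1 _; rewrite big1 // => m2 _.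
case: eqP => // m12; move: ijm; rewrite -m12 fdegM.
case: (ltnP i (fdeg m1)) => [/hx ->|im1]; first by rewrite mul0r.
case: (ltnP j (fdeg m2)) => [/hy ->|jm2]; first by rewrite mulr0.
by rewrite ltnNge leq_add.
Qed.
Definition ten_filtration : filtration (tenalg V) :=
  Filtration ten_fil_mono ten_fil1 ten_filM.
End Degrees.

(* The action of G on T(V) and S(V) respects the degree in V; G has degree 0. *)
Section ActDegrees.
Context {gT : finGroupType} {k : fieldType} {V : vectType k}.
Variable rho : linrep gT V.

Lemma sym_hom_symv v : sym_hom V 1 (symv v).
Proof.
apply: submod_sum => i; rewrite -[_ *: _]addr0.
apply: submod_memL; last exact: submod_mem0.
by rewrite /= /sym_hom_mem dhomogX /= mdeg1.
Qed.

Lemma sym_act_hom d g p :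
  sym_grading V d p -> sym_grading V d (sym_gaction rho g p).
Proof.
move=> hp; rewrite /= /sym_hom_mem /symlift comp_mpolyEX.
rewrite big_seq; apply: rpred_sum => m mp; apply: rpredZ.
rewrite -(dhomog_mf hp mp) comp_mpolyX /= mdegE.
elim/big_rec2: _ => [|i d' q _ hq]; first exact: dhomog1.
apply: dhomogM => //; rewrite -[X in X.-homog]mul1n; apply: dhomogMn.
by rewrite tnth_mktuple; exact: sym_hom_symv.
Qed.

Lemma ten_fil_tenv v : ten_fil V 1 (tenv v).
Proof.
apply: submod_sum => i; rewrite -[_ *: _]addr0.
apply: submod_memL; last exact: submod_mem0.
move=> m; rewrite monalg.mcoeffU; case: eqP => // <-.
by rewrite fdegU.
Qed.

Lemma ten_act_fil d g x :
  ten_filtration V d x -> ten_filtration V d (ten_gaction rho g x).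
Proof.
move=> hx; rewrite /= /tenlift monalg.mmapE.
have wordP (m : {fmonom 'I_(\dim {:V})}) :
    ten_fil V (fdeg m) (tenlift_word (tenv \o rho g) m).
  rewrite /tenlift_word /fdeg; elim: (fmonom_val m) => [|i s IHs].
    by rewrite big_nil; exact: ten_fil1.
  by rewrite big_cons -[size _]add1n; apply: ten_filM => //; exact: ten_fil_tenv.
apply: big_ind => [|y z hy hz|m _]; first exact: ten_fil0.
  by rewrite -[y]scale1r; exact: ten_filL.
rewrite /= mulr_algl; case: (leqP (fdeg m) d) => dm; last first.
  by rewrite hx // scale0r; exact: ten_fil0.
rewrite -[_ *: _]addr0; apply: ten_filL; last exact: ten_fil0.
by move=> m' dm'; apply: wordP; exact: leq_ltn_trans dm'.
Qed.

Definition symskew_grading : grading (symskew rho) :=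
  skew_grading sym_act_hom.
Definition tenskew_filtration : filtration (tenskew rho) :=
  skew_filtration ten_act_fil.
End ActDegrees.

(* A linear map from the p-th exterior power of V to W is encoded as an
   alternating multilinear function of p vectors. *)
Section Cochains.
Context {k : fieldType} {V : vectType k}.

Definition vupd p (v : {ffun 'I_p -> V}) (i : 'I_p) (x : V) : {ffun 'I_p -> V} :=
  [ffun j => if j == i then x else v j].

Definition multilinear p (W : lmodType k) (f : {ffun 'I_p -> V} -> W) : Prop :=
  forall i v a x y,
    f (vupd v i (a *: x + y)) = a *: f (vupd v i x) + f (vupd v i y).

Definition alternating p (W : lmodType k) (f : {ffun 'I_p -> V} -> W) : Prop :=
  multilinear f /\
  forall (v : {ffun 'I_p -> V}) i j, i != j -> v i = v j -> f v = 0.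

Definition pair2 (x y : V) : {ffun 'I_2 -> V} :=
  [ffun i => if i == 0 then x else y].

Definition omit p (i : 'I_p.+1) (v : {ffun 'I_p.+1 -> V}) : {ffun 'I_p -> V} :=
  [ffun j => v (lift i j)].

End Cochains.

Section DrinfeldOrbifold.
Context {gT : finGroupType} {k : fieldType} {V : vectType k}.
Variable rho : linrep gT V.

(* Maps into (k (+) V) (x) kG: the coefficient of g is a pair in k * V. *)
Local Notation kappa_type := ({ffun 'I_2 -> V} -> {ffun gT -> k^o * V}).

Definition kappa_elt (x : {ffun gT -> k^o * V}) : tenskew rho :=
  skew_of (ten_gaction rho) (fun g => (x g).1 *: 1 + tenv (x g).2).

Definition vec_elt (v : V) : tenskew rho :=
  skew_elt (ten_gaction rho) (tenv v) 1%g.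

Definition orbifold_rel (kappa : kappa_type) (r : tenskew rho) : Prop :=
  exists v w : V,
    r = vec_elt v * vec_elt w - vec_elt w * vec_elt v
        - kappa_elt (kappa (pair2 v w)).

Definition orbifold_ideal (kappa : kappa_type) : ideal2 (tenskew rho) :=
  ideal_gen (orbifold_rel kappa).

Definition Hkappa (kappa : kappa_type) := quotalg (orbifold_ideal kappa).

Definition gr_Hkappa (kappa : kappa_type) : graded_alg k :=
  gr (tenskew_filtration rho) (orbifold_ideal kappa).

Definition drinfeld_orbifold_algebra (kappa : kappa_type) : Prop :=
  graded_iso (gr_Hkappa kappa) (graded_of (symskew_grading rho)).

Definition cochain p := {ffun 'I_p -> V} -> symskew rho.

Definition symvec_elt (v : V) : symskew rho :=
  skew_elt (sym_gaction rho) (symv v) 1%g.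

(* With indices starting from 0, the sign (-1)^(i+1) becomes (-1)^i. *)
Definition dstar p (alpha : cochain p) : cochain p.+1 := fun v =>
  \sum_(i < p.+1) (-1) ^+ i *:
     (symvec_elt (v i) * alpha (omit i v) - alpha (omit i v) * symvec_elt (v i)).

Definition cocycle p (alpha : cochain p) : Prop := forall v, dstar alpha v = 0.

Definition coboundary p (alpha : cochain p.+1) : Prop :=
  exists beta : cochain p, alternating beta /\ forall v, alpha v = dstar beta v.

(* h.(s g) = (h.s) h g h^-1, read off on the coefficient of g. *)
Definition skew_conj (h : gT) (x : symskew rho) : symskew rho :=
  skew_of (sym_gaction rho)
    (fun g => sym_gaction rho h (skew_fun x (h^-1 * g * h)%g)).

Definition cochain_act p (h : gT) (alpha : cochain p) : cochain p := fun v =>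
  skew_conj h (alpha [ffun i => rho h^-1%g (v i)]).

Definition G_invariant p (alpha : cochain p) : Prop :=
  forall h v, cochain_act h alpha v = alpha v.

Definition fix_space (g : gT) : {vspace V} := fixedSpace (rho g).
Definition codim_fix (g : gT) : nat := \dim {:V} - \dim (fix_space g).

(* The sum of the eigenspaces of g for the eigenvalues other than 1. *)
Definition fix_perp (g : gT) (w : V) : Prop :=
  exists m (a : 'I_m -> k) (u : 'I_m -> V),
    (forall i, a i != 1 /\ u i \in passmx.leigenspace (rho g) (a i)) /\
    w = \sum_i u i.

(* The image of S(V^g) in S(V) under the inclusion of V^g in V. *)
Definition in_sym_fix (g : gT) (s : symalg V) : Prop :=
  exists q : mpoly (\dim (fix_space g)) k,
    s = comp_mpoly
      [tuple (symv (vbasis (fix_space g))`_i : mpoly _ k)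
      | i < \dim (fix_space g)] q.

Definition wedge p (l : 'I_p -> 'Hom(V, k^o)) (v : {ffun 'I_p -> V}) : k :=
  \det (\matrix_(i, j) (l i (v j) : k)).

(* The cochains s g (x) l_1 /\ ... /\ l_p with s in S(V^g), the first p - codim V^g
   functionals in (V^g)^* and the last codim V^g ones in ((V^g)^perp)^*; the dual
   of each summand of V is the space of functionals vanishing on the other one. *)
Definition H_generator p (g : gT) (alpha : cochain p) : Prop :=
  exists (s : symalg V) (l : 'I_p -> 'Hom(V, k^o)),
    [/\ in_sym_fix g s,
        (codim_fix g <= p)%N,
        forall i : 'I_p, (i < p - codim_fix g)%N ->
          forall w, fix_perp g w -> l i w = 0,
        forall i : 'I_p, (p - codim_fix g <= i)%N ->
          forall w, w \in fix_space g -> l i w = 0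
      & forall v, alpha v = skew_elt (sym_gaction rho) (wedge l v *: s) g].

Definition in_H p (alpha : cochain p) : Prop :=
  exists m (gs : 'I_m -> gT) (gens : 'I_m -> cochain p),
    (forall t, H_generator (gs t) (gens t)) /\
    forall v, alpha v = \sum_t gens t v.

Local Notation lin2 := ({ffun 'I_2 -> V} -> {ffun gT -> V}).

Definition lin_cochain (alpha : lin2) : cochain 2 := fun v =>
  skew_of (sym_gaction rho) (fun g => symv (alpha v g)).

(* The permutation s sends the position i in {0, 1, 2} to s i. *)
Definition bracket (alpha beta : lin2) : cochain 3 := fun v =>
  skew_of (sym_gaction rho) (fun g =>
    symv (\sum_h \sum_(s in ('Alt_('I_3))%g)
       (alpha (pair2 (beta (pair2 (v (s 0)) (v (s 1))) h) (v (s 2))) (g * h^-1)%g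
      + beta (pair2 (alpha (pair2 (v (s 0)) (v (s 1))) h) (v (s 2))) (g * h^-1)%g))).

Definition mk_kappa (kC : {ffun 'I_2 -> V} -> {ffun gT -> k^o}) (kL : lin2) :
    kappa_type :=
  fun v => [ffun g => (kC v g, kL v g)].

Definition has_all_eigenvalues : Prop :=
  forall g, exists rs : seq k,
    char_poly (passmx.mxof (vbasis {:V}) (vbasis {:V}) (rho g)) =
      \prod_(a <- rs) ('X - a%:P).

End DrinfeldOrbifold.

(* Main.v *)
Require Import Defs.
From HB Require Import structures.
From mathcomp Require Import all_boot all_fingroup all_algebra.
From mathcomp Require Import all_solvable all_field.
From mathcomp Require Import boolp.
From mathcomp Require Import finmap.
From mathcomp Require Import monalg ssrcomplements mpoly.
From mathcomp Require Import ring zify.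
Set Implicit Arguments.
Unset Strict Implicit.
Unset Printing Implicit Defensive.

Import GRing.Theory.
Local Open Scope ring_scope.

(** Every element of the abelian group G has finite order invertible in k and
    its eigenvalues in k, so the elements of G are simultaneously
    diagonalizable on V ([eigenbasis_exists]).  In an eigenbasis
    e_1, ..., e_n, with g e_i = lam_g(i) e_i, the linear cochain is given by
    structure constants: the coefficient of g in kL(e_i, e_j) is
    sum_p c_g(i,j,p) e_p.  Membership in (H^2)^G turns into three conditions
    on a nonzero constant c_g(i,j,p): the vector e_p is fixed by g
    ([stc_fixed]), every basis vector moved by g is e_i or e_j ([stc_moved]),
    and lam_h(p) = lam_h(i) lam_h(j) for all h ([stc_weight]).

    The bracket of kL with itself is twice a Jacobi expression.  On three
    distinct basis vectors these conditions force the coefficient of g in the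
    Jacobi expression to lie in V^g ([jac_coord_fix]): in a term
    c_h(a,b,p) c_(gh^-1)(p,d,q) the index d differs from a and b, so h fixes
    e_d as well as e_p, hence also e_q by the weight condition, while gh^-1
    fixes e_q.  On the other hand a coboundary has a coefficient at g in the
    ideal of S generated by the vectors v - g v, and the algebra map S -> S
    which projects V onto V^g along the other eigenspaces kills this ideal
    ([fix_quot_dstar]).  It acts trivially on V^g, so the coefficient of
    a coboundary at g vanishes if it lies in V^g.  As 2 is invertible, the
    Jacobi expression is 0 ([stc_jacobi]), and so is the bracket
    ([bracket0]).

    The second claim is a Poincare-Birkhoff-Witt theorem, proved by Serre's
    method for Lie algebras.  Over the commutative ring R = kG, the algebra
    T(V)#G is represented on the polynomial ring R[X_1, ..., X_n]: g multiplies
    a monomial of weight chi by chi(g) g, and e_i acts by an operator [opX]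
    whose leading term is multiplication by X_i and whose lower terms are
    forced by the relations, through a recursion that lets the variable of
    smallest index act last.  The Jacobi identity is what makes all the
    commutation relations hold ([opX_comm]), so the representation kills the
    ideal of relations ([skewop_ideal]).  Applied to the polynomial 1, an
    element of filtration degree d is sent to its image in S#G modulo
    polynomials of degree < d ([tenop_lead]); hence an element of the ideal
    has zero part of degree d in S#G ([symbol_size]).  Conversely, modulo the
    ideal and lower filtration degree the letters of a word commute
    ([low_mod_perm]), so the kernel of the map from filtration degree d to the
    degree d part of S#G is the ideal up to lower degree ([symbol_ker]).  This
    map therefore induces the isomorphism of the associated graded algebra of
    H_kappa with S#G ([graded_iso_of_symbol], [drinfeld_of_symbol]). *)

(** * Linear maps on polynomials and bounds on degrees *)

Lemma lincombB (R : pzRingType) (W : lmodType R) a (x y x' y' : W) :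
  a *: x + y - (a *: x' + y') = a *: (x - x') + (y - y').
Proof. by rewrite opprD addrACA -scalerBr. Qed.

Section LinearExtension.
Context {R : comNzRingType} {n : nat}.
Local Notation P := {mpoly R[n]}.

Lemma mpoly_lin_ind (Q : P -> Prop) d :
    Q 0 -> (forall a p q, Q p -> Q q -> Q (a *: p + q)) ->
    (forall m, (mdeg m < d)%N -> Q 'X_[m]) ->
  forall p, (msize p <= d)%N -> Q p.
Proof.
move=> Q0 QL QX p pd; rewrite [p]mpolyE big_seq.
apply: (big_ind Q) => // [x y Qx Qy|m /msize_mdeg_lt mp].
  by rewrite -[x]scale1r; apply: QL.
by rewrite -[_ *: _]addr0; apply: QL => //; apply: QX; exact: leq_trans mp pd.
Qed.

Lemma mpoly_linT_ind (Q : P -> Prop) :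
    Q 0 -> (forall a p q, Q p -> Q q -> Q (a *: p + q)) ->
    (forall m, Q 'X_[m]) -> forall p, Q p.
Proof. by move=> Q0 QL QX p; apply: (mpoly_lin_ind (d := msize p)). Qed.

Lemma msize_lin a (p q : P) d :
  (msize p <= d)%N -> (msize q <= d)%N -> (msize (a *: p + q) <= d)%N.
Proof.
move=> pd qd; apply: leq_trans (mmeasureD_le _ _ _) _.
by rewrite geq_max qd andbT (leq_trans (msizeZ_le _ _)).
Qed.

Lemma msizeD_leq (p q : P) d :
  (msize p <= d)%N -> (msize q <= d)%N -> (msize (p + q) <= d)%N.
Proof. by rewrite -[p in (p + _)]scale1r; exact: msize_lin. Qed.

Lemma msize_sum_leq (I : Type) (r : seq I) (S : pred I) (F : I -> P) d :
  (forall i, S i -> (msize (F i) <= d)%N) ->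
  (msize (\sum_(i <- r | S i) F i) <= d)%N.
Proof.
move=> Fd; apply: (big_ind (fun p => msize p <= d)%N) => //; first by rewrite msize0.
by move=> p q; exact: msizeD_leq.
Qed.

Lemma msizeM_leq (p q : P) d e :
  (msize p <= d.+1)%N -> (msize q <= e)%N -> (msize (p * q) <= d + e)%N.
Proof.
move=> pd qe; move: p pd; apply: mpoly_lin_ind => [|a p p' pq pq'|m md].
- by rewrite mul0r msize0.
- by rewrite mulrDl -scalerAl; exact: msize_lin.
move: q qe; apply: mpoly_lin_ind => [|a q q' mq mq'|m' m'e].
- by rewrite mulr0 msize0.
- by rewrite mulrDr -scalerAr; exact: msize_lin.
by rewrite -mpolyXD msizeX mdegD -addnS leq_add.
Qed.

Lemma msizeMX_leq i (p : P) d : (msize p <= d)%N -> (msize ('X_i * p) <= d.+1)%N.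
Proof. by rewrite -add1n; apply: msizeM_leq; rewrite msizeX mdeg1. Qed.

Context {W : lmodType R} (f : 'X_{1..n} -> W).

(** The linear extension of [f] from monomials.  The polynomial ring is free on
    its monomials; all the operators below are defined by this extension. *)
Definition mlin (p : P) : W := \sum_(m <- msupp p) p@_m *: f m.

(** With a bound on the degree that two polynomials share, the sum runs over an
    index set independent of the polynomial: this is what gives linearity. *)
Lemma mlinwE d p : (msize p <= d)%N ->
  mlin p = \sum_(m : 'X_{1..n < d}) p@_m *: f m.
Proof.
move=> pd; rewrite /mlin (big_mksub 'X_{1..n < d}) ?msupp_uniq //=; first last.
  by move=> x /msize_mdeg_lt /leq_trans; apply.
by rewrite big_rmcond //= => j /memN_msupp_eq0 ->; rewrite scale0r.
Qed.

Fact mlin_is_linear : linear mlin.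
Proof.
move=> a p q; pose d := maxn (msize p) (msize q).
have pd : (msize p <= d)%N by exact: leq_maxl.
have qd : (msize q <= d)%N by exact: leq_maxr.
rewrite !(@mlinwE d) ?msize_lin // scaler_sumr -big_split.
by apply: eq_bigr => m _; rewrite /= mcoeffD mcoeffZ scalerDl scalerA.
Qed.
HB.instance Definition _ := GRing.isLinear.Build R P W _ mlin mlin_is_linear.

Lemma mlinX m : mlin 'X_[m] = f m.
Proof. by rewrite /mlin msuppX big_seq1 mcoeffX eqxx scale1r. Qed.

End LinearExtension.

Section LinearSubstitution.
Context {R : comNzRingType} {n : nat}.
Local Notation P := {mpoly R[n]}.

Lemma mpoly_lrmorph_id (f : {lrmorphism P -> P}) :
  (forall i, f 'X_i = 'X_i) -> f =1 id.
Proof.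
move=> fX; apply: mpoly_linT_ind => [|a p q fp fq|m]; first exact: raddf0.
  by rewrite linearP /= fp fq.
rewrite mpolyXE_id rmorph_prod; apply: eq_bigr => i _.
by rewrite rmorphXn /= fX.
Qed.

Lemma msize_exp_leq (p : P) e : (msize p <= 2)%N -> (msize (p ^+ e) <= e.+1)%N.
Proof.
move=> p2; elim: e => [|e IHe]; first by rewrite expr0 msize1.
by rewrite exprS -[e.+2]add1n; exact: msizeM_leq.
Qed.

Lemma msize_comp_mpoly (lq : n.-tuple P) p d :
    (forall i, (msize (tnth lq i) <= 2)%N) ->
  (msize p <= d)%N -> (msize (p \mPo lq) <= d)%N.
Proof.
move=> lq2; move: p; apply: mpoly_lin_ind => [|a p q|m md].
- by rewrite raddf0 msize0.
- by rewrite linearP; exact: msize_lin.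
rewrite comp_mpolyX; apply: leq_trans md; rewrite mdegE.
elim/big_rec2: _ => [|i e p _ pe]; first by rewrite msize1.
by rewrite -addnS; apply: msizeM_leq => //; exact: msize_exp_leq.
Qed.

End LinearSubstitution.

(** * The smallest variable of a monomial *)
Section LowVar.
Context {n : nat}.
Implicit Types (m : 'X_{1..n}).

Definition le_mnm (i : 'I_n) m : bool := [forall j, (0 < m j)%N ==> (i <= j)%N].

Lemma le_mnmP (i : 'I_n) m : reflect (forall j, (0 < m j)%N -> (i <= j)%N) (le_mnm i m).
Proof.
by apply: (iffP forallP) => im j; [move=> mj; move: (im j); rewrite mj
  |apply/implyP/im].
Qed.

Lemma le_mnmD (nu i : 'I_n) m : (nu <= i)%N -> le_mnm nu m -> le_mnm nu (U_(i) + m)%MM.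
Proof.
move=> nui /le_mnmP num; apply/le_mnmP => j; rewrite mnmDE mnm1E.
by case: eqP => [<- //|_]; exact: num.
Qed.

(** The operators of the next part are defined by peeling the variable of
    smallest index off a monomial; the constant monomial has none. *)
Definition lowvar m : option 'I_n := [pick i | (0 < m i)%N && le_mnm i m].

Variant lowvar_spec m : option 'I_n -> Type :=
| LowNone of m = 0%MM : lowvar_spec m None
| LowSome nu of m = (U_(nu) + (m - U_(nu)))%MM & le_mnm nu (m - U_(nu))%MM
    & le_mnm nu m & mdeg m = (mdeg (m - U_(nu))%MM).+1 : lowvar_spec m (Some nu).

Lemma lowvarP m : lowvar_spec m (lowvar m).
Proof.
rewrite /lowvar; case: pickP => [nu /andP[nu0 nule]|no].
  have mE : m = (U_(nu) + (m - U_(nu)))%MM.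
    apply/mnmP => j; rewrite mnmDE mnmBE mnm1E; case: eqP => [<-|_] /=.
      by rewrite subnKC.
    by rewrite subn0.
  apply: LowSome => //; last by rewrite {1}mE mdegD mdeg1.
  apply/le_mnmP => j; rewrite mnmBE => mj; apply: (le_mnmP _ _ nule).
  exact: leq_trans mj (leq_subr _ _).
apply: LowNone; apply/eqP; rewrite -mdeg_eq0 mdegE sum_nat_eq0.
apply/forallP => i /=; apply: contraT; rewrite -lt0n => i0.
(* The least index occurring in m would have been picked. *)
have ex : exists j : nat, [exists i : 'I_n, (val i == j) && (0 < m i)%N].
  by exists i; apply/existsP; exists i; rewrite eqxx.
case: (ex_minnP ex) => j /existsP[i' /andP[/eqP <- i'0]] jmin.
have := no i'; rewrite i'0 /= => /negbT/negP[]; apply/le_mnmP => l l0.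
by apply: jmin; apply/existsP; exists l; rewrite eqxx.
Qed.

(** The converse of peeling: multiplying by a variable that is at most all those
    of [m] makes it the smallest one. *)
Lemma lowvarD nu m : le_mnm nu m -> lowvar (U_(nu) + m)%MM = Some nu.
Proof.
move=> /le_mnmP num; rewrite /lowvar; case: pickP => [i|/(_ nu)].
  case/andP; rewrite mnmDE mnm1E => i0 /le_mnmP/(_ nu).
  rewrite mnmDE mnm1E eqxx => /(_ isT) i_nu; congr Some; apply/val_inj/eqP => /=.
  rewrite eqn_leq i_nu /=; case: eqP i0 => [->//|_]; exact: num.
rewrite mnmDE mnm1E eqxx /= => /negbT/negP[]; apply/le_mnmP => j.
by rewrite mnmDE mnm1E; case: eqP => [->//|_]; apply: num.
Qed.

End LowVar.

(** * Operators on polynomials satisfying twisted commutation relations *)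
Section TwistedPBW.
Context {R : comNzRingType} {n : nat} {gT : finGroupType}.
(** The data model the relations
      X_i X_j - X_j X_i = sum_(g, q) c_g(i,j,q) X_q g,     g X_i = tau_g(i) X_i g
    where [t g], the image of g in the commutative ring [R], is its value on
    the constant polynomial 1.  [cinv] says that the right-hand side of the
    first relation has the weight of the left-hand side, [cfix] that the g
    occurring in it commute with every variable other than X_i and X_j, and
    [cjac] is the Jacobi identity. *)
Variables (t : gT -> R) (tau : gT -> 'I_n -> R).
Variable c : gT -> 'I_n -> 'I_n -> 'I_n -> R.
Local Notation P := {mpoly R[n]}.

Hypothesis tM : forall g h, t (g * h)%g = t g * t h.
Hypothesis tauM : forall g h i, tau (g * h)%g i = tau g i * tau h i.
Hypothesis cC : forall g i j p, c g j i p = - c g i j p.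
Hypothesis c0 : forall g i p, c g i i p = 0.
Hypothesis cinv :
  forall g h i j p, c g i j p * tau h p = c g i j p * (tau h i * tau h j).
Hypothesis cfix : forall g i j l p,
  i != j -> l != i -> l != j -> c g i j p * tau g l = c g i j p.
Hypothesis cjac : forall i j l, i != j -> l != i -> l != j ->
  forall g q, \sum_h \sum_p (c h i j p * c (g * h^-1)%g l p q
    + c h j l p * c (g * h^-1)%g i p q + c h l i p * c (g * h^-1)%g j p q) = 0.

Definition twist_wt g (m : 'X_{1..n}) : R := t g * \prod_i tau g i ^+ m i.

Definition twist g : P -> P := mlin (fun m => twist_wt g m *: 'X_[m]).
HB.instance Definition _ g := GRing.Linear.on (twist g).

Lemma twistX g m : twist g 'X_[m] = twist_wt g m *: 'X_[m].
Proof. exact: mlinX. Qed.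

Lemma twist_wt_mul g i m : twist_wt g (U_(i) + m)%MM = tau g i * twist_wt g m.
Proof.
rewrite /twist_wt mulrCA; congr (_ * _).
rewrite (bigD1 i) //= [in RHS](bigD1 i) //= mulrA -exprS; congr (_ * _).
  by rewrite mnmDE mnm1E eqxx.
by apply: eq_bigr => j ji; rewrite mnmDE mnm1E eq_sym (negPf ji).
Qed.

Lemma twistMX g i p : twist g ('X_i * p) = tau g i *: ('X_i * twist g p).
Proof.
move: p; apply: mpoly_linT_ind => [|a p q IHp IHq|m].
- by rewrite mulr0 raddf0 mulr0 scaler0.
- rewrite mulrDr -scalerAr !linearP /= IHp IHq mulrDr -scalerAr scalerDr.
  by rewrite !scalerA mulrC.
by rewrite -mpolyXD !twistX twist_wt_mul mpolyXD -scalerAr scalerA.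
Qed.

Lemma twistM g h p : twist g (twist h p) = twist (g * h)%g p.
Proof.
move: p; apply: mpoly_linT_ind => [|a p q IHp IHq|m]; first by rewrite !raddf0.
  by rewrite !linearP /= IHp IHq.
rewrite !twistX linearZ /= twistX scalerA; congr (_ *: _).
rewrite /twist_wt tM mulrACA [t h * _]mulrC; congr (_ * _).
by rewrite -big_split; apply: eq_bigr => i _; rewrite tauM exprMn mulrC.
Qed.

Lemma twist1 : t 1%g = 1 -> (forall i, tau 1%g i = 1) -> twist 1%g =1 id.
Proof.
move=> t1 tau1; apply: mpoly_linT_ind => [|a p q IHp IHq|m].
- by rewrite raddf0.
- by rewrite linearP /= IHp IHq.
rewrite twistX /twist_wt t1 mul1r big1 ?scale1r // => i _.
by rewrite tau1 expr1n.
Qed.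

Lemma msize_twist g p d : (msize p <= d)%N -> (msize (twist g p) <= d)%N.
Proof.
move: p; apply: mpoly_lin_ind => [|a p q|m md]; first by rewrite raddf0 msize0.
  by rewrite linearP; exact: msize_lin.
by rewrite twistX (leq_trans (msizeZ_le _ _)) // msizeX.
Qed.

(** The lower order part of the action of X_i.  The requirements are that X_i
    acts on a monomial in variables of index at least i by plain multiplication
    and that, on X_nu m' with nu the smallest variable and nu < i,
      X_i (X_nu m') = X_nu (X_i m') + sum_(g, q) c_g(i,nu,q) X_q (g m').
    On the right X_nu acts on X_i m', which contains a term of the same degree
    as X_nu m', so a recursion for the full operators would not decrease the
    degree.  But X_nu acts on that leading term by plain multiplication, so
    the corrections alone satisfy a recursion which involves polynomials of
    smaller degree only.  The natural number bounds the depth of the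
    recursion. *)
Fixpoint corr (d : nat) (i : 'I_n) : {linear P -> P} :=
  if d is d'.+1 then mlin (fun m =>
    if lowvar m is Some nu then
      if (i <= nu)%N then 0 else
        let m' := (m - U_(nu))%MM in
        'X_nu * corr d' i 'X_[m'] + corr d' nu (corr d' i 'X_[m'])
        + \sum_g \sum_q c g i nu q *:
            ('X_q * twist g 'X_[m'] + corr d' q (twist g 'X_[m']))
    else 0)
  else mlin (fun _ => 0).

Lemma corrX d i m : corr d.+1 i 'X_[m] =
  if lowvar m is Some nu then
    if (i <= nu)%N then 0 else
      let m' := (m - U_(nu))%MM in
      'X_nu * corr d i 'X_[m'] + corr d nu (corr d i 'X_[m'])
      + \sum_g \sum_q c g i nu q *:
          ('X_q * twist g 'X_[m'] + corr d q (twist g 'X_[m']))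
  else 0.
Proof. exact: mlinX. Qed.

Lemma corr_size d i p e : (msize p <= e)%N -> (msize (corr d i p) <= e)%N.
Proof.
elim: d i p e => [|d IHd] i p e.
  by rewrite /= /mlin big1 ?msize0 // => m _; rewrite scaler0.
move: p; apply: mpoly_lin_ind => [|a p q|m md].
- by rewrite raddf0 msize0.
- by rewrite linearP; exact: msize_lin.
rewrite corrX; case: lowvarP => [_|nu _ _ _ mS]; first by rewrite msize0.
case: ifP => _; first by rewrite msize0.
apply: leq_trans md; set m' := (m - U_(nu))%MM.
have m'd : (msize ('X_[m'] : P) <= mdeg m)%N by rewrite msizeX mS.
apply: msizeD_leq.
  by apply: msizeD_leq; [apply/msizeMX_leq/IHd|do 2!apply: (IHd); exact: ltnW].
do 2!apply: msize_sum_leq => ? _; apply: leq_trans (msizeZ_le _ _) _.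
apply: msizeD_leq; first by apply/msizeMX_leq/msize_twist.
by apply/IHd/msize_twist/ltnW.
Qed.

(** A depth that exceeds the degree of the polynomial is enough. *)
Lemma corr_stable d i p : (msize p <= d)%N -> corr d.+1 i p = corr d i p.
Proof.
elim: d i p => [|d IHd] i p.
  by rewrite leqn0 mmeasure_poly_eq0 => /eqP->; rewrite !raddf0.
move: p; apply: mpoly_lin_ind => [|a p q IHp IHq|m md].
- by rewrite !raddf0.
- by rewrite !linearP IHp IHq.
rewrite !corrX; case: lowvarP => // nu _ _ _ mS; case: ifP => // _.
set m' := (m - U_(nu))%MM; cbv zeta.
have m'd : (msize ('X_[m'] : P) <= d)%N by rewrite msizeX -mS.
have cd := corr_size d _ m'd.
rewrite !(IHd _ _ m'd) (IHd _ _ (cd _)); congr (_ + _).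
apply: eq_bigr => g _; apply: eq_bigr => q _.
by rewrite IHd // msize_twist.
Qed.

Definition opX_corr i : P -> P := mlin (fun m => corr (mdeg m).+1 i 'X_[m]).
HB.instance Definition _ i := GRing.Linear.on (opX_corr i).

Lemma corrE d i p : (msize p <= d)%N -> corr d i p = opX_corr i p.
Proof.
move: p; apply: mpoly_lin_ind => [|a p q IHp IHq|m md].
- by rewrite !raddf0.
- by rewrite !linearP IHp IHq.
rewrite /opX_corr mlinX -(subnK md) addnC.
by elim: (d - _)%N => [|e IHe]; rewrite ?addn0 // addnS corr_stable ?msizeX ?leq_addr.
Qed.

Lemma msize_opX_corr i p d : (msize p <= d)%N -> (msize (opX_corr i p) <= d)%N.
Proof. by move=> pd; rewrite -(corrE i pd); exact: corr_size. Qed.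

(** Locked, so that unification never unfolds an operator applied to a large
    polynomial into the recursion behind it. *)
Fact opX_key : unit. Proof. exact: tt. Qed.
Definition opX i : P -> P :=
  locked_with opX_key (fun p => 'X_i * p + opX_corr i p).

Lemma opXE i p : opX i p = 'X_i * p + opX_corr i p.
Proof. by rewrite /opX unlock. Qed.

Fact opX_is_linear i : linear (opX i).
Proof.
move=> a p q; rewrite !opXE mulrDr -scalerAr linearP scalerDr.
by rewrite addrACA.
Qed.
HB.instance Definition _ i :=
  GRing.isLinear.Build R P P _ (opX i) (opX_is_linear i).

Lemma opXX i m : opX i 'X_[m] = 'X_[U_(i) + m] + opX_corr i 'X_[m].
Proof. by rewrite opXE mpolyXD. Qed.

(** The value that the commutator of X_i and X_j must have. *)
Definition brk i j (p : P) : P := \sum_g \sum_q c g i j q *: opX q (twist g p).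

Fact brk_is_linear i j : linear (brk i j).
Proof.
move=> a p q; rewrite /brk scaler_sumr -big_split; apply: eq_bigr => g _.
rewrite scaler_sumr -big_split; apply: eq_bigr => l _ /=.
by rewrite !linearP /= !scalerA mulrC.
Qed.
HB.instance Definition _ i j :=
  GRing.isLinear.Build R P P _ (brk i j) (brk_is_linear i j).

Lemma opX_le (i : 'I_n) m : le_mnm i m -> opX i 'X_[m] = 'X_i * 'X_[m].
Proof.
move=> /le_mnmP im; rewrite opXE /opX_corr mlinX corrX.
case: lowvarP => [|nu mE]; first by rewrite addr0.
by rewrite im ?addr0 // mE mnmDE mnm1E eqxx.
Qed.

(** The defining recursion, now for the full operators. *)
Lemma opX_rec (i nu : 'I_n) m : le_mnm nu m -> (nu < i)%N ->
  opX i ('X_nu * 'X_[m]) = opX nu (opX i 'X_[m]) + brk i nu 'X_[m].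
Proof.
move=> num nui; rewrite -mpolyXD {1}opXE /opX_corr mlinX.
rewrite mdegD mdeg1 add1n corrX lowvarD // ifN -?ltnNge //; cbv zeta.
rewrite addmC addmK; set d := (mdeg m).+1.
have md : (msize ('X_[m] : P) <= d)%N by rewrite msizeX.
rewrite !corrE ?msize_opX_corr // addrA; congr (_ + _); last first.
  apply: eq_bigr => g _; apply: eq_bigr => q _.
  by rewrite corrE ?msize_twist // opXE.
rewrite opXX raddfD /= opX_le ?le_mnmD //; last exact: ltnW.
by rewrite opXE !mpolyXD [in RHS]mulrCA [_ * 'X_nu]mulrC addrA.
Qed.

Lemma twistC g h p : twist g (twist h p) = twist h (twist g p).
Proof.
move: p; apply: mpoly_linT_ind => [|a p q IHp IHq|m]; first by rewrite !raddf0.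
  by rewrite !linearP /= IHp IHq.
by rewrite !twistX !linearZ /= !twistX !scalerA mulrC.
Qed.

(** G acts compatibly because the corrections have the same weight as the
    leading terms, by [cinv]. *)
Lemma twist_opX h i p : twist h (opX i p) = tau h i *: opX i (twist h p).
Proof.
have [d pd] : exists d, (msize p <= d)%N by exists (msize p).
elim: d i p pd => [|d IHd] i p.
  by rewrite leqn0 mmeasure_poly_eq0 => /eqP->; rewrite !raddf0.
(* Plain multiplication by a variable is compatible with the action. *)
have low m k : le_mnm k m ->
    twist h (opX k 'X_[m]) = tau h k *: opX k (twist h 'X_[m]).
  by move=> km; rewrite opX_le // twistMX twistX linearZ /= opX_le // -scalerAr.
move: p; apply: mpoly_lin_ind => [|a p q IHp IHq|m md].
- by rewrite !raddf0.
- by rewrite !linearP /= IHp IHq.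
case: (lowvarP m) => [m0|nu mE num' num mS].
  by apply: low; apply/le_mnmP => j; rewrite m0 mnm0E.
have [i_nu|nu_i] := leqP i nu.
  by apply/low/le_mnmP => j mj; apply: leq_trans i_nu _; apply/(le_mnmP _ _ num).
move: (m - U_(nu))%MM mE num' md mS {num} => m' -> num md mS.
have m'd : (msize ('X_[m'] : P) <= d)%N by rewrite msizeX -mS.
have q1 : twist h (opX nu (opX i 'X_[m'])) = tau h nu *: opX nu (twist h (opX i 'X_[m'])).
  rewrite opXX !raddfD /= low ?le_mnmD //; last exact: ltnW.
  by rewrite IHd ?scalerDr // msize_opX_corr.
rewrite mpolyXD opX_rec // raddfD /= q1 IHd // twistMX twistX.
rewrite -scalerAr !linearZ /= opX_rec // !scalerDr !scalerA; congr (_ + _).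
  by congr (_ *: _); ring.
rewrite /brk !linear_sum; apply: eq_bigr => g _ /=.
rewrite !linear_sum; apply: eq_bigr => q _ /=.
rewrite linearZ /= IHd ?msize_twist // scalerA cinv twistC (twistX h).
by rewrite !linearZ /= !scalerA; congr (_ *: _); ring.
Qed.

Lemma brkC i j p : brk i j p = - brk j i p.
Proof.
rewrite /brk -sumrN; apply: eq_bigr => g _; rewrite -sumrN; apply: eq_bigr => q _.
by rewrite cC scaleNr.
Qed.

Lemma brkxx i p : brk i i p = 0.
Proof. by rewrite /brk big1 // => g _; rewrite big1 // => q _; rewrite c0 scale0r. Qed.

(** The commutator of X_l with the right-hand side of the relation for X_i, X_j,
    as soon as the g occurring in it commute with X_l. *)
Definition brk2 l i j p : P := \sum_g \sum_q c g i j q *: brk l q (twist g p).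

Lemma brk2C l i j p : brk2 l i j p = - brk2 l j i p.
Proof.
rewrite /brk2 -sumrN; apply: eq_bigr => g _; rewrite -sumrN; apply: eq_bigr => q _.
by rewrite cC scaleNr.
Qed.

Lemma brk2E l i j p : brk2 l i j p =
  \sum_g \sum_q (\sum_h \sum_r c h i j r * c (g * h^-1)%g l r q) *: opX q (twist g p).
Proof.
transitivity (\sum_h \sum_g \sum_q \sum_r
    (c h i j r * c (g * h^-1)%g l r q) *: opX q (twist g p)).
  (* g is the product of the two group elements, the inner one being h. *)
  apply: eq_bigr => h _; rewrite [RHS](reindex_inj (mulIg h)) /=.
  under eq_bigr do rewrite scaler_sumr.
  rewrite exchange_big; apply: eq_bigr => g _; rewrite exchange_big.
  apply: eq_bigr => q _; rewrite scaler_sumr; apply: eq_bigr => r _.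
  by rewrite mulgK scalerA twistM.
rewrite exchange_big; apply: eq_bigr => g _; rewrite exchange_big.
apply: eq_bigr => q _; rewrite scaler_suml; apply: eq_bigr => h _.
by rewrite scaler_suml.
Qed.

Lemma brk2_jacobi i j l p : i != j -> l != i -> l != j ->
  brk2 l i j p + brk2 i j l p + brk2 j l i p = 0.
Proof.
move=> ij li lj; rewrite !brk2E -!big_split big1 // => g _ /=.
rewrite -!big_split big1 // => q _ /=; rewrite -!scalerDl -!big_split /=.
under eq_bigr do rewrite -!big_split /=.
by rewrite cjac // scale0r.
Qed.

(** The commutation relations on polynomials of degree less than [d]. *)
Definition comm_upto d := forall i j p, (msize p <= d)%N ->
  opX i (opX j p) = opX j (opX i p) + brk i j p.

(** For three distinct indices X_l passes the g in the relation for X_i, X_j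
    by [cfix], so only the commutators of X_l with the X_q remain. *)
Lemma opX_brk d i j l p : comm_upto d -> (msize p <= d)%N ->
    i != j -> l != i -> l != j ->
  opX l (brk i j p) = brk i j (opX l p) + brk2 l i j p.
Proof.
move=> comm pd ij li lj; rewrite /brk /brk2 linear_sum -big_split.
apply: eq_bigr => g _ /=; rewrite linear_sum -big_split; apply: eq_bigr => q _ /=.
rewrite linearZ /= comm ?msize_twist // scalerDr twist_opX linearZ /= scalerA.
by rewrite cfix.
Qed.

(** When X_j multiplies without correction the relation is the recursion that
    defines the operators. *)
Lemma comm_le (i j : 'I_n) m : le_mnm j m -> (j < i)%N ->
  opX i (opX j 'X_[m]) = opX j (opX i 'X_[m]) + brk i j 'X_[m].
Proof. by move=> jm ji; rewrite opX_le // opX_rec. Qed.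

(** The inductive step of Serre's proof.  Let X_j, with j < i, act on a monomial
    whose smallest variable X_nu has nu < j, and write the monomial as
    X_nu u.  Expanding X_i X_j X_nu u and X_j X_i X_nu u, each pair can be
    exchanged, either because it is applied to a polynomial of smaller degree
    or because X_nu is smaller than everything in the leading term.  The
    resulting error is the Jacobi expression of i, j and nu. *)
Lemma comm_step d : comm_upto d -> comm_upto d.+1.
Proof.
move=> IHd.
suff lt_case (i j : 'I_n) m : (j < i)%N -> (mdeg m < d.+1)%N ->
    opX i (opX j 'X_[m]) = opX j (opX i 'X_[m]) + brk i j 'X_[m].
  move=> i j; apply: mpoly_lin_ind => [|a p q IHp IHq|m md].
  - by rewrite !raddf0 addr0.
  - by rewrite !linearP /= IHp IHq scalerDr addrACA.
  case: (ltngtP i j) => [ij|ji|/val_inj->]; last by rewrite brkxx addr0.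
    by rewrite brkC (lt_case j i) // addrK.
  exact: lt_case.
move=> ji md; case: (lowvarP m) => [m0|nu mE num' num mS].
  by apply: comm_le => //; apply/le_mnmP => l; rewrite m0 mnm0E.
have [j_nu|nu_j] := leqP j nu.
  apply: comm_le => //; apply/le_mnmP => l ml.
  by apply: leq_trans j_nu _; apply/(le_mnmP _ _ num).
move: (m - U_(nu))%MM mE num' md mS {num} => m' -> num md mS.
have m'd : (msize ('X_[m'] : P) <= d)%N by rewrite msizeX -mS.
have nu_i := ltn_trans nu_j ji.
rewrite mpolyXD -(opX_le num); set u : P := 'X_[m'] in m'd *.
(* The leading term of X_b u only contains variables of index at least nu; the
   correction has degree below the bound of the induction hypothesis. *)
have swap (a b : 'I_n) : (nu < a)%N -> (nu < b)%N ->
    opX a (opX nu (opX b u)) = opX nu (opX a (opX b u)) + brk a nu (opX b u).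
  move=> nu_a nu_b; rewrite opXX !raddfD /=.
  rewrite comm_le ?le_mnmD //; last exact: ltnW.
  by rewrite (IHd a nu (opX_corr b u)) ?msize_opX_corr // addrACA.
have ij : i != j by rewrite -val_eqE /= gtn_eqF.
have nui : nu != i by rewrite -val_eqE /= ltn_eqF.
have nuj : nu != j by rewrite -val_eqE /= ltn_eqF.
rewrite (IHd j nu) // (IHd i nu) // !raddfD /= !swap //.
rewrite (IHd i j) // raddfD /= (opX_brk IHd m'd ij nui nuj).
rewrite (opX_brk (i := j) (j := nu) (l := i) IHd m'd) 1?eq_sym // 1?eq_sym //.
rewrite (opX_brk (i := i) (j := nu) (l := j) IHd m'd) 1?eq_sym // 1?eq_sym //.
have := brk2_jacobi u ij nui nuj; rewrite (brk2C j nu i).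
move: (opX nu _) (brk i j _) (brk2 nu i j u) (brk i nu _) (brk j nu _) (brk2 i j nu u).
move: (brk2 j i nu u) => e3 x a e1 b b' e2 /subr0_eq <-.
by rewrite -!addrA; congr (_ + _); rewrite [RHS]addrCA [LHS]addrA [a + _]addrC; ring.
Qed.

Theorem opX_comm i j p : opX i (opX j p) = opX j (opX i p) + brk i j p.
Proof.
suff : comm_upto (msize p) by apply.
elim: (msize p) => [|d /comm_step//] {}i {}j {}p.
by rewrite leqn0 mmeasure_poly_eq0 => /eqP->; rewrite !raddf0 addr0.
Qed.

Lemma opX_lead i p d : (msize p <= d)%N -> (msize (opX i p - 'X_i * p) <= d)%N.
Proof. by move=> pd; rewrite opXE addrC addKr msize_opX_corr. Qed.

End TwistedPBW.

(** * Maps out of a skew group algebra, and the group algebra *)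
Section SkewLift.
Context {gT : finGroupType} {k : fieldType} {A : algType k}.
Variable act : gaction gT A.

Lemma skewNE (x : skewalg act) g : skew_fun (- x) g = - skew_fun x g.
Proof. exact: ffunE. Qed.

Lemma skew_eltE a g h : skew_fun (skew_elt act a g) h = if h == g then a else 0.
Proof. exact: skew_ofE. Qed.

Lemma skew_elt_is_linear g : linear (skew_elt act ^~ g).
Proof.
move=> a x y; apply: skewP => h; rewrite skewDE skewZE !skew_eltE.
by case: ifP => // _; rewrite scaler0 addr0.
Qed.

Lemma skew_eltM a b g h :
  skew_elt act a g * skew_elt act b h = skew_elt act (a * act g b) (g * h)%g.
Proof.
apply: skewP => u; rewrite skewME (bigD1 g) //= big1 ?addr0.
  rewrite !skew_eltE eqxx -(inj_eq (mulgI g)) mulKVg.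
  by case: ifP => // _; rewrite raddf0 mulr0.
by move=> v /negPf vg; rewrite skew_eltE vg mul0r.
Qed.

Lemma skew_sumE (I : Type) (r : seq I) (F : I -> skewalg act) h :
  skew_fun (\sum_(i <- r) F i) h = \sum_(i <- r) skew_fun (F i) h.
Proof.
apply: (big_morph (fun x : skewalg act => skew_fun x h)) => [x y|].
  exact: skewDE.
exact: ffunE.
Qed.

Lemma skewE (x : skewalg act) : x = \sum_g skew_elt act (x g) g.
Proof.
apply: skewP => h; rewrite skew_sumE (bigD1 h) //= big1 ?addr0.
  by rewrite skew_eltE eqxx.
by move=> g gh; rewrite skew_eltE eq_sym (negPf gh).
Qed.

Context {B : algType k} (f : {lrmorphism A -> B}) (t : gT -> B).
Hypothesis tM : forall g h, t (g * h)%g = t g * t h.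
Hypothesis tf : forall g a, t g * f a = f (act g a) * t g.

(** The universal property of A#G: an algebra map on A and a multiplicative map
    on G which intertwines the action extend to A#G. *)
Definition skewlift (x : skewalg act) : B := \sum_g f (x g) * t g.

Fact skewlift_is_linear : linear skewlift.
Proof.
move=> a x y; rewrite /skewlift scaler_sumr -big_split; apply: eq_bigr => g _ /=.
by rewrite skewDE skewZE linearP mulrDl scalerAl.
Qed.
HB.instance Definition _ :=
  GRing.isLinear.Build k (skewalg act) B _ skewlift skewlift_is_linear.

Lemma skewlift_elt a g : skewlift (skew_elt act a g) = f a * t g.
Proof.
rewrite /skewlift (bigD1 g) //= skew_eltE eqxx big1 ?addr0 // => h /negPf hg.
by rewrite skew_eltE hg raddf0 mul0r.
Qed.

Lemma skewliftM x y : skewlift (x * y) = skewlift x * skewlift y.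
Proof.
rewrite [x in LHS]skewE [y in LHS]skewE mulr_suml !linear_sum mulr_suml.
apply: eq_bigr => g _ /=; rewrite mulr_sumr linear_sum mulr_sumr.
apply: eq_bigr => h _ /=; rewrite skew_eltM skewlift_elt rmorphM tM.
by rewrite -!mulrA; congr (_ * _); rewrite !mulrA tf.
Qed.

End SkewLift.

(** The kernel of a multiplicative linear map is a two-sided ideal. *)
Lemma ideal_gen_ker (k : fieldType) (A B : algType k) (X : A -> Prop)
    (f : {linear A -> B}) : {morph f : x y / x * y} ->
  (forall r, X r -> f r = 0) -> forall x, ideal_gen X x -> f x = 0.
Proof.
move=> fM fX x Ix.
have k0 : f 0 = 0 by exact: raddf0.
have kL a y z : f y = 0 -> f z = 0 -> f (a *: y + z) = 0.
  by rewrite linearP => -> ->; rewrite scaler0 addr0.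
have kMl a y : f y = 0 -> f (a * y) = 0 by rewrite fM => ->; rewrite mulr0.
have kMr a y : f y = 0 -> f (y * a) = 0 by rewrite fM => ->; rewrite mul0r.
exact: (Ix (@Ideal2 k A (Submod k0 kL) kMl kMr)).
Qed.

Section GroupAlgebra.
Context {gT : finGroupType} {k : fieldType}.

Definition triv_gaction : gaction gT k^o :=
  @GAction gT k k^o (fun _ => idfun) (frefl _) (fun _ _ => frefl _).

(** kG is the skew group algebra for the trivial action on k.  The type carries
    the proof that G is abelian, so that its commutative ring structure can be
    inferred. *)
Definition grpalg (abG : abelian [set: gT]) : Type := skewalg triv_gaction.

Variable abG : abelian [set: gT].
HB.instance Definition _ := GRing.Algebra.on (grpalg abG).

Fact grpalg_mulC : commutative (@GRing.mul (grpalg abG)).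
Proof.
move=> x y; rewrite [x]skewE [y]skewE mulr_suml mulr_sumr.
apply: eq_bigr => g _; rewrite mulr_suml mulr_sumr; apply: eq_bigr => h _.
rewrite !skew_eltM mulrC; congr skew_elt.
by apply: (centsP abG); rewrite inE.
Qed.
HB.instance Definition _ :=
  GRing.PzRing_hasCommutativeMul.Build (grpalg abG) grpalg_mulC.

Definition grp_elt (g : gT) : grpalg abG := skew_elt triv_gaction 1 g.

Lemma grp_eltM g h : grp_elt (g * h)%g = grp_elt g * grp_elt h.
Proof. by rewrite [RHS]skew_eltM mulr1. Qed.

Lemma grp_elt1 : grp_elt 1%g = 1. Proof. by []. Qed.

(** The elements of G are linearly independent in kG. *)
Lemma grp_elt_free (a : gT -> k) :
  \sum_g a g *: grp_elt g = 0 -> forall g, a g = 0.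
Proof.
move=> a0 g.
have := congr1 (fun x : skewalg triv_gaction => skew_fun x g) a0.
rewrite skew_sumE (bigD1 g) //= big1 ?addr0 => [|h hg].
  by rewrite skewZE skew_eltE eqxx /skew_fun ffunE => <-; exact/esym/mulr1.
by rewrite skewZE skew_eltE eq_sym (negPf hg); exact: scaler0.
Qed.

End GroupAlgebra.
Arguments grpalg {gT} k abG.
Arguments grp_elt {gT k} abG g.

(** * The algebra of endomorphisms of a polynomial ring *)
Section PolyEndo.
Context {k : fieldType} {R : comAlgType k} {n : nat}.
Local Notation P := {mpoly R[n]}.

(** The R-linear endomorphisms of R[X_1, ..., X_n], as an algebra over k only:
    this is the target of a representation of the k-algebra T(V)#G. *)
Record endo := Endo { endo_fun :> P -> P; endo_linP : `[< linear endo_fun >] }.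

HB.instance Definition _ := [isSub for endo_fun].
HB.instance Definition _ := [Choice of endo by <:].

Lemma endo_lin (f : endo) : linear f. Proof. exact/asboolP/endo_linP. Qed.
HB.instance Definition _ (f : endo) :=
  GRing.isLinear.Build R P P _ (endo_fun f) (endo_lin f).

Definition mk_endo (f : {linear P -> P}) : endo :=
  Endo (introT (asboolP _) (linearP f)).

Lemma endoP (f g : endo) : (forall p, f p = g p) -> f = g.
Proof. by move=> fg; apply/val_inj/funext. Qed.

Lemma endo_add_subproof (f g : endo) : linear (fun p => f p + g p).
Proof. by move=> a p q; rewrite !linearP scalerDr addrACA. Qed.
Lemma endo_opp_subproof (f : endo) : linear (fun p => - f p).
Proof. by move=> a p q; rewrite linearP opprD scalerN. Qed.
Lemma endo_zero_subproof : linear (fun _ : P => 0 : P).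
Proof. by move=> a p q; rewrite scaler0 addr0. Qed.
Lemma endo_one_subproof : linear (fun p : P => p).
Proof. by []. Qed.
Lemma endo_mul_subproof (f g : endo) : linear (fun p => f (g p)).
Proof. by move=> a p q; rewrite !linearP. Qed.
Lemma endo_scale_subproof (a : k) (f : endo) : linear (fun p => a%:A *: f p).
Proof. by move=> b p q; rewrite linearP scalerDr !scalerA mulrC. Qed.

Definition endo_add f g := Endo (introT (asboolP _) (endo_add_subproof f g)).
Definition endo_opp f := Endo (introT (asboolP _) (endo_opp_subproof f)).
Definition endo_zero := Endo (introT (asboolP _) endo_zero_subproof).
Definition endo_one := Endo (introT (asboolP _) endo_one_subproof).
Definition endo_mul f g := Endo (introT (asboolP _) (endo_mul_subproof f g)).
Definition endo_scale a f := Endo (introT (asboolP _) (endo_scale_subproof a f)).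

Fact endo_addA : associative endo_add.
Proof. by move=> f g h; apply: endoP => p /=; rewrite addrA. Qed.
Fact endo_addC : commutative endo_add.
Proof. by move=> f g; apply: endoP => p /=; rewrite addrC. Qed.
Fact endo_add0 : left_id endo_zero endo_add.
Proof. by move=> f; apply: endoP => p /=; rewrite add0r. Qed.
Fact endo_addN : left_inverse endo_zero endo_opp endo_add.
Proof. by move=> f; apply: endoP => p /=; rewrite addNr. Qed.
HB.instance Definition _ :=
  GRing.isZmodule.Build endo endo_addA endo_addC endo_add0 endo_addN.

Fact endo_mulA : associative endo_mul. Proof. by move=> f g h; apply: endoP. Qed.
Fact endo_mul1 : left_id endo_one endo_mul. Proof. by move=> f; apply: endoP. Qed.
Fact endo_mulr1 : right_id endo_one endo_mul.
Proof. by move=> f; apply: endoP. Qed.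
Fact endo_mulDl : left_distributive endo_mul +%R.
Proof. by move=> f g h; apply: endoP. Qed.
Fact endo_mulDr : right_distributive endo_mul +%R.
Proof. by move=> f g h; apply: endoP => p /=; rewrite linearD. Qed.
Fact endo_1neq0 : endo_one != 0.
Proof.
by apply/eqP => /(congr1 (fun f : endo => f 1)) /= /eqP; rewrite oner_eq0.
Qed.
HB.instance Definition _ := GRing.Zmodule_isNzRing.Build endo
  endo_mulA endo_mul1 endo_mulr1 endo_mulDl endo_mulDr endo_1neq0.

Fact endo_scaleA a b f : endo_scale a (endo_scale b f) = endo_scale (a * b) f.
Proof. by apply: endoP => p /=; rewrite scalerA -scalerAl mul1r scalerA. Qed.
Fact endo_scale1 : left_id 1 endo_scale.
Proof. by move=> f; apply: endoP => p /=; rewrite !scale1r. Qed.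
Fact endo_scaleDr : right_distributive endo_scale +%R.
Proof. by move=> a f g; apply: endoP => p /=; rewrite scalerDr. Qed.
Fact endo_scaleDl f : {morph endo_scale^~ f : a b / a + b}.
Proof. by move=> a b; apply: endoP => p /=; rewrite !scalerDl. Qed.
HB.instance Definition _ := GRing.Zmodule_isLmodule.Build k endo
  endo_scaleA endo_scale1 endo_scaleDr endo_scaleDl.

Fact endo_scaleAl a (f g : endo) : a *: (f * g) = (a *: f) * g.
Proof. exact: endoP. Qed.
HB.instance Definition _ := GRing.Lmodule_isLalgebra.Build k endo endo_scaleAl.
Fact endo_scaleAr a (f g : endo) : a *: (f * g) = f * (a *: g).
Proof. by apply: endoP => p; rewrite /= [RHS]linearZ. Qed.
HB.instance Definition _ := GRing.Lalgebra_isAlgebra.Build k endo endo_scaleAr.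

Lemma endoDE (f g : endo) p : endo_fun (f + g) p = f p + g p. Proof. by []. Qed.
Lemma endoME (f g : endo) p : endo_fun (f * g) p = f (g p). Proof. by []. Qed.
Lemma endoZE a (f : endo) p : endo_fun (a *: f) p = a%:A *: f p.
Proof. by []. Qed.
Lemma endo_sumE (I : Type) (r : seq I) (F : I -> endo) p :
  endo_fun (\sum_(i <- r) F i) p = \sum_(i <- r) F i p.
Proof. exact: (big_morph (fun f : endo => f p)). Qed.

End PolyEndo.
Arguments endo {k} R n.

(** * Words in the tensor algebra and their images in S#G *)
Section TensorWords.
Context {k : fieldType} {V : vectType k}.
Local Notation n := (\dim {:V}).

Definition word (s : seq 'I_n) : tenalg V := \prod_(i <- s) tenX i.

Lemma word_cons i s : word (i :: s) = tenX i * word s.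
Proof. exact: big_cons. Qed.

Lemma ten_fil_word s d : (size s <= d)%N -> ten_fil V d (word s).
Proof.
move=> sd m dm; rewrite /word.
have -> : \prod_(i <- s) (tenX i : tenalg V) = << FMonom s >>.
  exact: (tenX_prod (FMonom s)).
rewrite monalg.mcoeffU; case: eqP => // ms; move: dm; rewrite -ms.
by rewrite ltnNge sd.
Qed.

(** The words of length at most [d] span the filtration piece of degree [d]. *)
Lemma ten_word_ind (Q : tenalg V -> Prop) d :
    Q 0 -> (forall a x y, Q x -> Q y -> Q (a *: x + y)) ->
    (forall s, (size s <= d)%N -> Q (word s)) ->
  forall x, ten_fil V d x -> Q x.
Proof.
move=> Q0 QL Qw x xd; rewrite [x]monalgE big_seq.
apply: (big_ind Q) => // [y z Qy Qz|m mx].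
  by rewrite -[y]scale1r; apply: QL.
rewrite [X in Q X]malgU_scale -tenX_prod -[_ *: _]addr0; apply: QL => //.
apply: Qw; rewrite leqNgt; apply/negP => /xd x0.
by move: mx; rewrite -monalg.mcoeff_neq0 x0 eqxx.
Qed.

Lemma ten_fil_ex (x : tenalg V) : exists d, ten_fil V d x.
Proof.
exists (\max_(m <- monalg.msupp x) fdeg m)%N => m dm.
apply/eqP; rewrite -[_ == _]negbK monalg.mcoeff_neq0; apply: contraL dm => mx.
by rewrite -leqNgt (leq_bigmax_seq _ mx).
Qed.

Lemma ten_wordT_ind (Q : tenalg V -> Prop) :
    Q 0 -> (forall a x y, Q x -> Q y -> Q (a *: x + y)) ->
    (forall s, Q (word s)) -> forall x, Q x.
Proof.
by move=> Q0 QL Qw x; have [d] := ten_fil_ex x; apply: ten_word_ind.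
Qed.

Definition ten_sym : {lrmorphism tenalg V -> symalg V} := tenlift symv.

Lemma ten_symv v : ten_sym (tenv v) = symv v. Proof. exact: tenliftv. Qed.

Lemma ten_symX i : ten_sym (tenX i) = symX i.
Proof. by rewrite -tenv_base ten_symv symv_base. Qed.

End TensorWords.

Section SkewSymbol.
Context {gT : finGroupType} {k : fieldType} {V : vectType k}.
Variable rho : linrep gT V.

(** The projection T(V) -> S(V) is G-equivariant, so it extends to T(V)#G. *)
Lemma ten_sym_act g x : ten_sym (ten_gaction rho g x) = sym_gaction rho g (ten_sym x).
Proof.
apply: (tenalg_ext (f := ten_sym \o ten_act rho g)
  (g := sym_act rho g \o ten_sym)) => v.
apply: (etrans (congr1 ten_sym (ten_actv rho g v))).
apply: (etrans (ten_symv (rho g v))); apply: esym.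
exact: (etrans (congr1 (sym_act rho g) (ten_symv v)) (sym_actv rho g v)).
Qed.

Definition skew_sym (x : tenskew rho) : symskew rho :=
  skew_of (sym_gaction rho) (fun g => ten_sym (skew_fun x g)).

Lemma skew_symE x g : skew_fun (skew_sym x) g = ten_sym (skew_fun x g).
Proof. exact: skew_ofE. Qed.

Fact skew_sym_is_linear : linear skew_sym.
Proof.
move=> a x y; apply: skewP => g.
rewrite skewDE skewZE !skew_symE -linearP.
by rewrite skewDE skewZE.
Qed.
HB.instance Definition _ :=
  GRing.isLinear.Build k (tenskew rho) (symskew rho) _ skew_sym skew_sym_is_linear.

Lemma skew_symM x y : skew_sym (x * y) = skew_sym x * skew_sym y.
Proof.
apply: skewP => g; rewrite skew_symE !skewME rmorph_sum; apply: eq_bigr => h _.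
by rewrite rmorphM !skew_symE; congr (_ * _); exact: ten_sym_act.
Qed.

End SkewSymbol.

(** * Change of coordinates *)
Section CoordinateChange.
Context {k : fieldType} {R : comAlgType k} {V : vectType k}.
Local Notation n := (\dim {:V}).
Local Notation P := {mpoly R[n]}.
Variable e : n.-tuple V.
Hypothesis eB : basis_of fullv e.

(** The algebras S(V) and T(V) are built on the standard basis of V, while the
    operators are indexed by an eigenbasis [e].  A vector is a linear form in
    either set of variables; [to_e] and [to_v] substitute one for the other. *)
Definition elin (v : V) : P := \sum_j (coord e j v)%:A *: 'X_j.
Definition vlin (v : V) : P := \sum_i (vcoord i v)%:A *: 'X_i.

Lemma msize_lin_form (a : 'I_n -> R) : (msize (\sum_i a i *: 'X_i : P) <= 2)%N.
Proof.
apply: msize_sum_leq => i _; apply: leq_trans (msizeZ_le _ _) _.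
by rewrite msizeX mdeg1.
Qed.

Definition to_e : P -> P := comp_mpoly [tuple elin (vbase i) | i < n].
Definition to_v : P -> P := comp_mpoly [tuple vlin e`_i | i < n].
HB.instance Definition _ := GRing.LRMorphism.on to_e.
HB.instance Definition _ := GRing.LRMorphism.on to_v.

Lemma to_eX i : to_e 'X_i = elin (vbase i).
Proof. by rewrite /to_e comp_mpolyXU -tnth_nth tnth_mktuple. Qed.

Lemma to_vX i : to_v 'X_i = vlin e`_i.
Proof. by rewrite /to_v comp_mpolyXU -tnth_nth tnth_mktuple. Qed.

Lemma to_eK : cancel to_e to_v.
Proof.
move=> p; apply: (mpoly_lrmorph_id (f := to_v \o to_e)) => i /=.
have vlinE : vlin (vbase i) = 'X_i.
  rewrite /vlin (bigD1 i) //= vcoord_base eqxx !scale1r big1 ?addr0 // => l li.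
  by rewrite vcoord_base eq_sym (negPf li) !scale0r.
rewrite to_eX linear_sum -[RHS]vlinE /vlin.
under eq_bigr do rewrite linearZ /= to_vX scaler_sumr.
rewrite exchange_big; apply: eq_bigr => l _.
under eq_bigr do rewrite scalerA -scalerAl mul1r scalerA.
rewrite -scaler_suml -scaler_suml; congr (_ *: _); congr (_ *: _).
rewrite [in RHS](coord_basis eB (memvf (vbase i))) /vcoord linear_sum.
by apply: eq_bigr => j _; rewrite linearZ.
Qed.

Lemma msize_to_v p d : (msize p <= d)%N -> (msize (to_v p) <= d)%N.
Proof.
apply: msize_comp_mpoly => i; rewrite tnth_mktuple; exact: msize_lin_form.
Qed.

(** S(V) seen in the polynomial ring over R in the coordinates of [e]. *)
Definition sym_eval (s : symalg V) : P := to_e (map_mpoly (in_alg R) s).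

Lemma sym_evalM x y : sym_eval (x * y) = sym_eval x * sym_eval y.
Proof. by rewrite /sym_eval !rmorphM. Qed.

Lemma sym_eval1 : sym_eval 1 = 1.
Proof. by rewrite /sym_eval !rmorph1. Qed.

Lemma sym_evalL a x y :
  sym_eval (a *: x + y) = a%:A *: sym_eval x + sym_eval y.
Proof. by rewrite /sym_eval rmorphD /= map_mpolyZ linearP. Qed.

Lemma sym_evalX i : sym_eval (symX i) = elin (vbase i).
Proof. by rewrite /sym_eval /symX map_mpolyX to_eX. Qed.

Lemma sym_evalK s : to_v (sym_eval s) = map_mpoly (in_alg R) s.
Proof. exact: to_eK. Qed.

End CoordinateChange.

Section EigenCoordinates.
Context {gT : finGroupType} {k : fieldType} {V : vectType k}.
Variable rho : linrep gT V.
Local Notation n := (\dim {:V}).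
Variables (e : n.-tuple V) (lam : gT -> 'I_n -> k).
Hypothesis eB : basis_of fullv e.
Hypothesis elam : forall g (i : 'I_n), rho g e`_i = lam g i *: e`_i.

Lemma coord_sumE (v : V) : v = \sum_i coord e i v *: e`_i.
Proof. exact: coord_basis eB (memvf v). Qed.

Lemma coord_basis_id (i j : 'I_n) : coord e i e`_j = (j == i)%:R.
Proof. by rewrite (coord_free _ _ (basis_free eB)). Qed.

Lemma coord_rho g v i : coord e i (rho g v) = lam g i * coord e i v.
Proof.
rewrite [v in LHS]coord_sumE !linear_sum (bigD1 i) //= big1.
  by rewrite !linearZ /= elam linearZ /= coord_basis_id eqxx addr0 mulr1 mulrC.
move=> j ji; rewrite !linearZ /= elam linearZ /= coord_basis_id.
by rewrite (negPf ji) !mulr0.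
Qed.

Lemma lamM g h (i : 'I_n) : lam (g * h)%g i = lam g i * lam h i.
Proof.
have := coord_rho (g * h)%g e`_i i.
by rewrite lrepM lfunE /= !coord_rho coord_basis_id eqxx !mulr1.
Qed.

Lemma lam1 (i : 'I_n) : lam 1%g i = 1.
Proof.
have := coord_rho 1%g e`_i i.
by rewrite lrep1 lfunE /= coord_basis_id eqxx mulr1.
Qed.

End EigenCoordinates.

(** * The representation of T(V)#G on polynomials over kG *)
Section Representation.
Context {gT : finGroupType} {k : fieldType} {V : vectType k}.
Variables (rho : linrep gT V) (abG : abelian [set: gT]).
Local Notation n := (\dim {:V}).
Local Notation R := (grpalg k abG).
Local Notation P := (mpoly n R).
Variables (e : n.-tuple V) (lam : gT -> 'I_n -> k).
Hypothesis eB : basis_of fullv e.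
Hypothesis elam : forall g (i : 'I_n), rho g e`_i = lam g i *: e`_i.
Variable c : gT -> 'I_n -> 'I_n -> 'I_n -> k.
Hypothesis cC : forall g i j p, c g j i p = - c g i j p.
Hypothesis c0 : forall g i p, c g i i p = 0.
Hypothesis cinv :
  forall g h i j p, c g i j p * lam h p = c g i j p * (lam h i * lam h j).
Hypothesis cfix : forall g (i j l : 'I_n) p,
  i != j -> l != i -> l != j -> c g i j p * lam g l = c g i j p.
Hypothesis cjac : forall i j l : 'I_n, i != j -> l != i -> l != j ->
  forall g q, \sum_h \sum_p (c h i j p * c (g * h^-1)%g l p q
    + c h j l p * c (g * h^-1)%g i p q + c h l i p * c (g * h^-1)%g j p q) = 0.

Definition tauR g i : R := (lam g i)%:A.
Definition cR g i j p : R := (c g i j p)%:A.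

Local Notation opx := (opX (grp_elt abG) tauR cR).
Local Notation twi := (twist (n := n) (grp_elt abG) tauR).

(** Vectors act through their coordinates in the eigenbasis. *)
Definition opv (v : V) : endo R n :=
  \sum_i coord e i v *: mk_endo (opx i).

Fact opv_is_linear : linear opv.
Proof.
move=> a u v; rewrite scaler_sumr -big_split; apply: eq_bigr => i _ /=.
by rewrite linearP scalerDl scalerA.
Qed.
HB.instance Definition _ := GRing.isLinear.Build k V _ _ opv opv_is_linear.

Definition opg (g : gT) : endo R n := mk_endo (twi g).

Lemma inalgM (a b : k) : (a * b)%:A = a%:A * b%:A :> R.
Proof. by rewrite -scalerAl mul1r scalerA. Qed.

Lemma opg1 : opg 1%g = 1.
Proof.
apply: endoP => p; apply: twist1 => [|i]; first exact: grp_elt1.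
by rewrite /tauR (lam1 eB elam) scale1r.
Qed.

Lemma tauRM g h i : tauR (g * h)%g i = tauR g i * tauR h i.
Proof. by rewrite /tauR (lamM eB elam) inalgM. Qed.

Lemma opgM g h : opg (g * h)%g = opg g * opg h.
Proof.
apply: endoP => p; apply: esym; apply: twistM; last exact: tauRM.
exact: grp_eltM.
Qed.

Lemma cRC g i j p : cR g j i p = - cR g i j p.
Proof. by rewrite /cR cC scaleNr. Qed.

Lemma cR0 g i p : cR g i i p = 0. Proof. by rewrite /cR c0 scale0r. Qed.

Lemma cRinv g h i j p :
  cR g i j p * tauR h p = cR g i j p * (tauR h i * tauR h j).
Proof. by rewrite /cR /tauR -!inalgM cinv. Qed.

Lemma cRfix g (i j l : 'I_n) p :
  i != j -> l != i -> l != j -> cR g i j p * tauR g l = cR g i j p.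
Proof. by move=> ij li lj; rewrite /cR /tauR -inalgM cfix. Qed.

Lemma cRjac (i j l : 'I_n) : i != j -> l != i -> l != j ->
  forall g q, \sum_h \sum_p (cR h i j p * cR (g * h^-1)%g l p q
    + cR h j l p * cR (g * h^-1)%g i p q + cR h l i p * cR (g * h^-1)%g j p q) = 0.
Proof.
move=> ij li lj g q; have /(congr1 (fun a : k => a%:A : R)) := cjac ij li lj g q.
rewrite scale0r; apply: etrans; rewrite scaler_suml; apply: eq_bigr => h _.
rewrite scaler_suml.
by apply: eq_bigr => p _; rewrite !scalerDl !inalgM.
Qed.

Lemma opvE v p : opv v p = \sum_i (coord e i v)%:A *: opx i p.
Proof. by rewrite endo_sumE; apply: eq_bigr => i _; rewrite endoZE. Qed.

Lemma opg_opv g v : opg g * opv v = opv (rho g v) * opg g.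
Proof.
apply: endoP => p; rewrite !endoME !opvE linear_sum; apply: eq_bigr => i _.
rewrite linearZ /= (twist_opX _ cRinv) (coord_rho eB elam) scalerA inalgM.
by congr (_ *: _); exact: mulrC.
Qed.

Definition tenop : tenalg V -> endo R n := tenlift opv.
HB.instance Definition _ := GRing.LRMorphism.on tenop.

Lemma tenopv v : tenop (tenv v) = opv v. Proof. exact: tenliftv. Qed.

Lemma tenopM x y : tenop (x * y) = tenop x * tenop y.
Proof. exact: rmorphM. Qed.

Lemma opg_tenop g x : opg g * tenop x = tenop (ten_gaction rho g x) * opg g.
Proof.
move: x; apply: ten_wordT_ind => [|a x y IHx IHy|s].
- by rewrite !raddf0 mulr0 mul0r.
- by rewrite !linearP mulrDr -scalerAr IHx IHy mulrDl scalerAl.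
elim: s => [|i s IHs]; first by rewrite /word big_nil !rmorph1 mulr1 mul1r.
have e1 : tenop (word (i :: s)) = opv (vbase i) * tenop (word s).
  by rewrite word_cons -tenv_base; apply: etrans (tenopM _ _) _; rewrite tenopv.
have e2 : tenop (ten_gaction rho g (word (i :: s))) =
    opv (rho g (vbase i)) * tenop (ten_gaction rho g (word s)).
  have -> : ten_gaction rho g (word (i :: s)) =
      tenv (rho g (vbase i)) * ten_gaction rho g (word s).
    rewrite word_cons rmorphM; congr (_ * _); rewrite -tenv_base.
    exact: ten_actv.
  apply: etrans (tenopM _ _) _; congr (_ * _); exact: tenopv.
apply: (etrans (congr1 ( *%R (opg g)) e1)); apply: esym.
apply: (etrans (congr1 ( *%R^~ (opg g)) e2)).
move: (tenop (word s)) (tenop (ten_gaction rho g (word s))) IHs => a b IHs.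
by rewrite -[LHS]mulrA -IHs [LHS]mulrA -opg_opv -[LHS]mulrA.
Qed.

Definition skewop : tenskew rho -> endo R n := skewlift tenop opg.
HB.instance Definition _ := GRing.Linear.on skewop.

Lemma skewopM : {morph skewop : x y / x * y}.
Proof. by move=> x y; apply: skewliftM; [exact: opgM|exact: opg_tenop]. Qed.

Lemma skewop_vec v : skewop (vec_elt rho v) = opv v.
Proof.
by rewrite [LHS]skewlift_elt opg1 mulr1; exact: tenopv.
Qed.

Lemma skewop_comm_sub x y z :
  skewop (x * y - y * x - z) = skewop x * skewop y - skewop y * skewop x - skewop z.
Proof.
have sB a b : skewop (a - b) = skewop a - skewop b by exact: raddfB.
apply: etrans (sB _ _) _; apply: (congr1 (fun a => a - skewop z)).
apply: etrans (sB _ _) _.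
exact: (congr2 (fun a b => a - b) (skewopM x y) (skewopM y x)).
Qed.

(* Stated for an abstract group: the terms it is applied to are too large to be
   matched against a pattern. *)
Let eq_subr0 (U : zmodType) (a b : U) : a = b -> a - b = 0.
Proof. by move->; rewrite subrr. Qed.

Lemma skewop_rel v w z : skewop z = opv v * opv w - opv w * opv v ->
  skewop (vec_elt rho v * vec_elt rho w - vec_elt rho w * vec_elt rho v - z) = 0.
Proof.
move=> zE; apply: etrans (skewop_comm_sub _ _ _) _; apply: eq_subr0.
apply: (etrans _ (esym zE)); apply: (congr2 (fun a b => a - b)).
  exact: (congr2 *%R (skewop_vec v) (skewop_vec w)).
exact: (congr2 *%R (skewop_vec w) (skewop_vec v)).
Qed.

(** The operators satisfy the relations of H_kappa as soon as the c_g(i,j,p) are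
    the structure constants of kL, so they factor through H_kappa. *)
Section Relations.
Variable kL : {ffun 'I_2 -> V} -> {ffun gT -> V}.
Hypothesis kLc : forall v w g p, coord e p (kL (pair2 v w) g) =
  \sum_i \sum_j coord e i v * coord e j w * c g i j p.

Lemma opv_comm v w : opv v * opv w - opv w * opv v =
  \sum_g opv (kL (pair2 v w) g) * opg g.
Proof.
apply: endoP => p.
have opvv a b : (opv a * opv b) p =
    \sum_i \sum_j (coord e i a * coord e j b)%:A *: opx i (opx j p).
  rewrite endoME opvE; apply: eq_bigr => i _; rewrite opvE linear_sum scaler_sumr.
  by apply: eq_bigr => j _; rewrite linearZ scalerA inalgM.
rewrite endo_sumE -[LHS]/((opv v * opv w) p - (opv w * opv v) p) !opvv.
rewrite [X in _ - X]exchange_big -sumrB.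
transitivity (\sum_i \sum_j \sum_g \sum_q
    (coord e i v * coord e j w * c g i j q)%:A *: opx q (twi g p)).
  apply: eq_bigr => i _; rewrite -sumrB; apply: eq_bigr => j _ /=.
  rewrite [coord e j w * _]mulrC -scalerBr.
  rewrite (opX_comm _ tauRM cRC cR0 cRinv cRfix cRjac); last exact: grp_eltM.
  rewrite addrC addKr scaler_sumr; apply: eq_bigr => g _.
  by rewrite scaler_sumr; apply: eq_bigr => q _; rewrite scalerA -inalgM.
rewrite [RHS](eq_bigr (fun g => \sum_q \sum_i \sum_j
  (coord e i v * coord e j w * c g i j q)%:A *: opx q (twi g p))); last first.
  move=> g _; rewrite endoME opvE; apply: eq_bigr => q _.
  rewrite kLc !scaler_suml; apply: eq_bigr => i _.
  by rewrite !scaler_suml.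
rewrite exchange_big.
under eq_bigr do rewrite exchange_big.
rewrite exchange_big; apply: eq_bigr => g _.
rewrite [RHS]exchange_big.
under [RHS]eq_bigr do rewrite exchange_big.
by rewrite [RHS]exchange_big.
Qed.

Lemma skewop_ideal x :
  orbifold_ideal rho (mk_kappa (fun _ => 0) kL) x -> skewop x = 0.
Proof.
apply: ideal_gen_ker => [|r [v [w ->]]]; first exact: skewopM.
apply: skewop_rel; rewrite opv_comm; apply: eq_bigr => g _.
rewrite skew_ofE /mk_kappa ffunE /= ffunE scale0r add0r; congr (_ * _).
exact: tenopv.
Qed.

End Relations.

Local Notation seval := (sym_eval (R := R) e).

(** Up to lower degree, a vector acts as multiplication by its linear form. *)
Lemma opv_lead v p d : (msize p <= d)%N -> (msize (opv v p - elin e v * p) <= d)%N.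
Proof.
move=> pd; rewrite opvE /elin mulr_suml -sumrB; apply: msize_sum_leq => i _.
rewrite -scalerAl -scalerBr; apply: leq_trans (msizeZ_le _ _) _.
exact: opX_lead.
Qed.

Lemma tenop_word_cons i s p :
  tenop (word (i :: s)) p = opv (vbase i) (tenop (word s) p).
Proof.
have -> : tenop (word (i :: s)) = tenop (tenv (vbase i)) * tenop (word s).
  by rewrite word_cons -tenv_base; exact: tenopM.
by rewrite endoME; congr (endo_fun _ _); exact: tenopv.
Qed.

Lemma ten_sym_word_cons i s :
  seval (ten_sym (word (i :: s))) = elin e (vbase i) * seval (ten_sym (word s)).
Proof.
have -> : ten_sym (word (i :: s)) = symX i * ten_sym (word s).
  by rewrite word_cons; apply: etrans (rmorphM _ _ _) _; congr (_ * _); exact: ten_symX.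
by rewrite sym_evalM sym_evalX.
Qed.

(** Hence, by induction on words, an element of T(V) maps the polynomial 1 to
    its own image in S(V) up to lower degree. *)
Lemma tenop_lead x d : ten_fil V d x ->
  (msize (tenop x 1%R - seval (ten_sym x)) <= d)%N.
Proof.
move: x; apply: ten_word_ind => [|a x y xd yd|s].
- by rewrite !raddf0 (_ : seval 0 = 0) ?subr0 ?msize0 // /sym_eval !raddf0.
- rewrite (linearP tenop) (linearP ten_sym) sym_evalL endoDE endoZE.
  move: (tenop x 1) (tenop y 1) (seval (ten_sym x)) (seval (ten_sym y)) xd yd.
  by move=> p q p' q' pd qd; rewrite lincombB; exact: msize_lin.
move=> sd; apply: leq_trans sd.
(* The bound on the degree of the image in S(V) is needed to multiply on. *)
suff [] : (msize (tenop (word s) 1%R - seval (ten_sym (word s))) <= size s)%N /\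
    (msize (seval (ten_sym (word s))) <= (size s).+1)%N by [].
elim: s => [|i s [IH1 IH2]].
  rewrite /word big_nil !rmorph1 sym_eval1.
  by rewrite (_ : endo_fun _ _ = 1) // subrr msize0 msize1.
rewrite tenop_word_cons ten_sym_word_cons /=.
move: (tenop (word s) 1) (seval (ten_sym (word s))) IH1 IH2 => p q pq q1.
split; last first.
  rewrite -[(size s).+2]add1n; apply: msizeM_leq => //; exact: msize_lin_form.
have p1 : (msize p <= (size s).+1)%N.
  by rewrite -(subrK q p); apply: msizeD_leq => //; exact: leqW.
rewrite -(subrK (elin e (vbase i) * p) (opv (vbase i) p)) -addrA.
apply: msizeD_leq; first exact: opv_lead.
rewrite -mulrBr -add1n; apply: msizeM_leq => //; exact: msize_lin_form.
Qed.

Lemma grp_indep (a : gT -> k) : \sum_g grp_elt abG g * (a g)%:A = 0 ->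
  forall g, a g = 0.
Proof.
move=> s0; apply: (@grp_elt_free _ _ abG); apply: etrans s0.
by apply: eq_bigr => g _; rewrite -scalerAr mulr1.
Qed.

(** An element x of the ideal acts by 0.  Applying it to 1 gives
    sum_g g x_g(1), where x_g(1) is the image of x_g in S(V) up to degree < d;
    as the elements of G are independent over k, each of these images has
    degree < d. *)
Theorem symbol_size (kL : {ffun 'I_2 -> V} -> {ffun gT -> V}) x d :
    (forall v w g p, coord e p (kL (pair2 v w) g) =
      \sum_i \sum_j coord e i v * coord e j w * c g i j p) ->
    tenskew_filtration rho d x ->
    orbifold_ideal rho (mk_kappa (fun _ => 0) kL) x ->
  forall g, (msize (skew_fun (skew_sym x) g : mpoly n k) <= d)%N.
Proof.
move=> kLc xd xI.
have : skewop x 1 = 0 by rewrite (skewop_ideal kLc xI).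
have opg_1 g : opg g 1 = grp_elt abG g *: 1.
  rewrite -mpolyX0; apply: etrans (twistX _ _ _ _) _; congr (_ *: _).
  by rewrite /twist_wt big1 ?mulr1 // => i _; rewrite mnm0E expr0.
have skewop1 : skewop x 1 = \sum_g grp_elt abG g *: tenop (skew_fun x g) 1.
  rewrite [LHS]endo_sumE; apply: eq_bigr => g _.
  by rewrite endoME opg_1 linearZ.
rewrite skewop1 => x0.
pose y : (mpoly n R) := \sum_g grp_elt abG g *: seval (skew_fun (skew_sym x) g).
have yd : (msize y <= d)%N.
  have -> : y = \sum_g (- grp_elt abG g) *:
      (tenop (skew_fun x g) 1 - seval (ten_sym (skew_fun x g))).
    rewrite /y -[LHS]subr0 -[X in _ - X]x0 -sumrB; apply: eq_bigr => g _.
    by rewrite skew_symE scalerBr !scaleNr opprK addrC.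
  apply: msize_sum_leq => g _; apply: leq_trans (msizeZ_le _ _) _.
  exact/tenop_lead/xd.
(* Back in the standard coordinates the coefficients of each image lie in k. *)
have := msize_to_v e yd; rewrite /y linear_sum /=.
rewrite (eq_bigr (fun g =>
    grp_elt abG g *: map_mpoly (in_alg R) (skew_fun (skew_sym x) g)));
  last by move=> g _; rewrite linearZ /= sym_evalK.
move=> zd g; rewrite msizeE; apply/bigmax_leqP_seq => m mx _.
rewrite ltnNge; apply/negP => dm.
suff z0 : mpoly.mcoeff m (skew_fun (skew_sym x) g) = 0.
  by move: mx; rewrite mpoly.mcoeff_msupp z0 eqxx.
move: (g); apply: grp_indep.
have := memN_msupp_eq0 (msize_mdeg_ge (leq_trans zd dm)).
rewrite raddf_sum /= => z0; apply: etrans z0; apply: eq_bigr => h _.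
by rewrite mcoeffZ mcoeff_map_mpoly.
Qed.

End Representation.

(** * Homogeneous parts and a section of T(V) -> S(V) *)
Section HomogeneousPart.
Context {R : comNzRingType} {n : nat}.
Implicit Types p q : mpoly n R.
Local Notation pihom := (pihomog mdeg).

Lemma pihomog_small d p : (msize p <= d)%N -> pihom d p = 0.
Proof.
move=> pd; rewrite pihomogE big1_seq // => m /andP[/eqP md] /msize_mdeg_lt.
by rewrite md ltnNge pd.
Qed.

Lemma mcoeff_pihomog d p m :
  mpoly.mcoeff m (pihom d p) = if mdeg m == d then mpoly.mcoeff m p else 0.
Proof.
move: p; apply: mpoly_linT_ind => [|a p q IHp IHq|m'].
- by rewrite !raddf0 if_same.
- by rewrite linearP !mcoeffD !mcoeffZ IHp IHq; case: ifP; rewrite ?mulr0 ?addr0.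
rewrite pihomogX; case: ifP => m'd; case: ifP => md //; rewrite ?mcoeff0 //.
  by rewrite mcoeffX; case: eqP => // m'm; rewrite m'm md in m'd.
by rewrite mcoeffX; case: eqP => // m'm; rewrite m'm md in m'd.
Qed.

Lemma msize_leq_coef p d :
  (forall m, (d <= mdeg m)%N -> mpoly.mcoeff m p = 0) -> (msize p <= d)%N.
Proof.
move=> p0; rewrite msizeE; apply/bigmax_leqP_seq => m mx _.
by rewrite ltnNge; apply/negP => /p0 m0; move: mx; rewrite mpoly.mcoeff_msupp m0 eqxx.
Qed.

Lemma mcoeff_small p d m : (msize p <= d)%N -> (d <= mdeg m)%N -> mpoly.mcoeff m p = 0.
Proof. by move=> pd dm; apply/memN_msupp_eq0/msize_mdeg_ge/(leq_trans pd). Qed.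

Lemma msize_sub_pihomog d p : (msize p <= d.+1)%N -> (msize (p - pihom d p) <= d)%N.
Proof.
move=> pd; apply: msize_leq_coef => m; rewrite leq_eqVlt mcoeffB mcoeff_pihomog eq_sym.
by case: eqP => [_|_ /(mcoeff_small pd) ->]; rewrite subrr.
Qed.

Lemma msize_homog d p : p \is d.-homog -> (msize p <= d.+1)%N.
Proof.
move=> /dhomogP ph; rewrite msizeE; apply/bigmax_leqP_seq => m mx _.
by rewrite ph.
Qed.

Lemma msize_pihomog d p : (msize (pihom d p) <= d.+1)%N.
Proof. exact/msize_homog/pihomogP. Qed.

(** The parts of top degree multiply, like leading coefficients. *)
Lemma pihomogM i j p q : (msize p <= i.+1)%N -> (msize q <= j.+1)%N ->
  pihom (i + j)%N (p * q) = pihom i p * pihom j q.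
Proof.
move=> pi qj.
(* All but the first summand have degree below i + j. *)
have -> : p * q = pihom i p * pihom j q +
    (pihom i p * (q - pihom j q) + (p - pihom i p) * q).
  by rewrite mulrBr mulrBl; ring.
rewrite raddfD /= (pihomog_dE (dhomogM (pihomogP _ _ _) (pihomogP _ _ _))).
rewrite [X in _ + X]pihomog_small ?addr0 //; apply: msizeD_leq.
  by apply: msizeM_leq; [exact: msize_pihomog|exact: msize_sub_pihomog].
by rewrite mulrC addnC; apply: msizeM_leq => //; exact: msize_sub_pihomog.
Qed.

End HomogeneousPart.

Section SymmetricSection.
Context {k : fieldType} {V : vectType k}.
Local Notation n := (\dim {:V}).

Lemma sym_lin_ind (Q : symalg V -> Prop) d :
    Q 0 -> (forall a (x y : symalg V), Q x -> Q y -> Q (a *: x + y)) ->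
    (forall m : 'X_{1..n}, (mdeg m < d)%N -> Q (mpolyX k m)) ->
  forall s : symalg V, (msize (s : mpoly n k) <= d)%N -> Q s.
Proof. exact: mpoly_lin_ind. Qed.

Lemma sym_linT_ind (Q : symalg V -> Prop) :
    Q 0 -> (forall a (x y : symalg V), Q x -> Q y -> Q (a *: x + y)) ->
    (forall m : 'X_{1..n}, Q (mpolyX k m)) ->
  forall s : symalg V, Q s.
Proof. exact: mpoly_linT_ind. Qed.

Lemma ten_sym_word (s : seq 'I_n) : ten_sym (word s) = mpolyX k (s2m s).
Proof.
have -> : ten_sym (word s) = \prod_(i <- s) symX i.
  elim: s => [|i s IHs]; first by rewrite /word !big_nil rmorph1.
  rewrite word_cons big_cons -IHs; apply: etrans (rmorphM _ _ _) _.
  by congr (_ * _); exact: ten_symX.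
elim: s => [|i s IHs].
  by rewrite big_nil -mpolyX0; congr mpolyX; apply/mnmP => i; rewrite mnmE mnm0E.
rewrite big_cons IHs -mpolyXD; congr mpolyX.
by apply/mnmP => j; rewrite mnmDE mnm1E !mnmE.
Qed.

(** The linear section of T(V) -> S(V) which lists the variables of a monomial
    in increasing order. *)
Definition sym_sec : symalg V -> tenalg V := mlin (fun m => word (m2s m)).
HB.instance Definition _ := GRing.Linear.on sym_sec.

Lemma sym_secL a (p q : symalg V) :
  sym_sec (a *: p + q) = a *: sym_sec p + sym_sec q.
Proof. exact: mlin_is_linear. Qed.

Lemma ten_symL a (x y : tenalg V) :
  ten_sym (a *: x + y) = a *: ten_sym x + ten_sym y.
Proof. exact: linearP. Qed.

Lemma sym_secX m : sym_sec (mpolyX k m) = word (m2s m).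
Proof. exact: mlinX. Qed.

Lemma sym_secK s : ten_sym (sym_sec s) = s.
Proof.
move: s; apply: sym_linT_ind => [|a p q IHp IHq|m].
- by rewrite !raddf0.
- apply: etrans (congr1 ten_sym (sym_secL a p q)) _.
  apply: etrans (ten_symL _ _ _) _.
  exact: (congr2 (fun x y => a *: x + y) IHp IHq).
by rewrite sym_secX ten_sym_word s2mK.
Qed.

Lemma sym_sec_fil d (s : symalg V) :
  (msize (s : mpoly n k) <= d.+1)%N -> ten_fil V d (sym_sec s).
Proof.
move: s; apply: sym_lin_ind => [|a p q pd qd|m md].
- by rewrite (raddf0 sym_sec); exact: ten_fil0.
- exact: (eq_ind_r (fun x => ten_fil V d x) (ten_filL a pd qd) (sym_secL a p q)).
by rewrite sym_secX; apply: ten_fil_word; rewrite size_m2s.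
Qed.

Lemma perm_m2s (s : seq 'I_n) : perm_eq s (m2s (s2m s)).
Proof.
apply/allP => i _ /=.
by have := congr1 (fun m : 'X_{1..n} => m i) (s2mK (s2m s)); rewrite !mnmE => ->.
Qed.

Lemma msize_ten_sym d x : ten_fil V d x -> (msize (ten_sym x : mpoly n k) <= d.+1)%N.
Proof.
move: x; apply: ten_word_ind => [|a x y|s sd]; first by rewrite raddf0 msize0.
  by rewrite linearP; exact: msize_lin.
by rewrite ten_sym_word msizeX ltnS -size_m2s -(perm_size (perm_m2s s)).
Qed.

End SymmetricSection.

(** * The associated graded algebra of a quotient, from a symbol map *)
Section GradedIso.
Context {k : fieldType} {A B : algType k}.
Variables (F : filtration A) (I : ideal2 A) (D : grading B).
Variable sigma : nat -> {linear A -> B}.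
Hypothesis sigma_hom : forall d x, F d x -> D d (sigma d x).
Hypothesis sigma1 : sigma 0 1 = 1.
Hypothesis sigmaM : forall i j x y, F i x -> F j y ->
  sigma (i + j)%N (x * y) = sigma i x * sigma j y.
Hypothesis sigma_surj : forall d b, D d b -> exists2 x, F d x & sigma d x = b.
Hypothesis sigma_low : forall d x, F d x -> sigma d.+1 x = 0.
Hypothesis sigma_ideal : forall d x, F d x -> I x -> sigma d x = 0.

(** The elements which vanish in degree d of the associated graded algebra of
    A/I: they are in the ideal up to lower filtration degree, that is, up to
    0 when d = 0. *)
Definition low_mod d (x : A) : Prop :=
  if d is d'.+1 then exists2 y, F d' y & I (x - y) else I x.

Hypothesis sigma_ker : forall d x, F d x -> sigma d x = 0 -> low_mod d x.

Lemma low_modP d x : low_mod d x <-> @qfil_pred_mem k A F I d (aclass I x).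
Proof.
case: d => [|d] /=; first by rewrite -[x in I x]subr0 -aclass_eq raddf0.
split=> [[y Fy /aclass_eq xy]|[y Fy /aclass_eq xy]]; by exists y.
Qed.

Lemma low_mod_sigma d x : F d x -> low_mod d x -> sigma d x = 0.
Proof.
case: d => [|d] Fx /=; first exact: sigma_ideal.
move=> [y Fy Ixy]; have Fy' := fil_mono Fy.
have Fxy : F d.+1 (x - y) by rewrite -scaleN1r addrC; exact: submod_memL.
by have := sigma_ideal Fxy Ixy; rewrite linearB /= (sigma_low Fy) subr0.
Qed.

(** The class in the associated graded algebra of A/I of an element of A of
    filtration degree d. *)
Definition gr_of d x (Fx : F d x) : gr_piece F I d :=
  gr_class (ex_intro2 _ _ x Fx erefl : qfil F I d (aclass I x)).

(** The symbol is both well defined and injective on classes: two elements have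
    the same class exactly if they have the same symbol. *)
Lemma gr_of_eq d x y (Fx : F d x) (Fy : F d y) :
  gr_of Fx = gr_of Fy <-> sigma d x = sigma d y.
Proof.
have Fxy : F d (x - y) by rewrite -scaleN1r addrC; exact: submod_memL.
have eqL : gr_of Fx = gr_of Fy <-> low_mod d (x - y).
  rewrite low_modP raddfB; exact: (qclass_eq (qfil_pred F I d)).
rewrite eqL; split=> [/(low_mod_sigma Fxy)/eqP|/eqP xy].
  by rewrite linearB subr_eq0 => /eqP.
by apply: sigma_ker => //; apply/eqP; rewrite linearB subr_eq0.
Qed.

Lemma gr_of_surj d (q : gr_piece F I d) : exists x, exists Fx : F d x, q = gr_of Fx.
Proof.
have qE : qclass (qfil_pred F I d) (gr_repr q) = q by exact: qclassK.
have [x Fx xE] := submod_type_mem (gr_repr q).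
exists x, Fx; rewrite -qE; apply/qclass_eq.
have z0 : val (gr_repr q - submod_elt (ex_intro2 _ _ x Fx erefl :
    qfil F I d (aclass I x))) = 0 by rewrite raddfB /= xE subrr.
suff : @qfil_pred_mem k A F I d (val (gr_repr q - submod_elt
    (ex_intro2 _ _ x Fx erefl : qfil F I d (aclass I x)))) by [].
by rewrite z0; case: (d) => //= d'; exact: qfil_mem0.
Qed.

Definition gr_lift d (q : gr_piece F I d) : A := projT1 (cid (gr_of_surj q)).

Lemma gr_lift_fil d (q : gr_piece F I d) : F d (gr_lift q).
Proof. by rewrite /gr_lift; case: cid => x /= [Fx _]. Qed.

Lemma gr_liftK d (q : gr_piece F I d) : q = gr_of (gr_lift_fil q).
Proof.
have [Fx qE] : exists Fx : F d (gr_lift q), q = gr_of Fx.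
  by rewrite /gr_lift; case: cid.
by rewrite [LHS]qE; apply/gr_of_eq.
Qed.

Definition gr_phi d (q : gr_piece F I d) : hpiece D d :=
  submod_elt (sigma_hom (gr_lift_fil q)).

Lemma gr_phi_of d x (Fx : F d x) : val (gr_phi (gr_of Fx)) = sigma d x.
Proof. by apply/(gr_of_eq (gr_lift_fil _) Fx); rewrite -gr_liftK. Qed.

Fact gr_phi_is_linear d : linear (@gr_phi d).
Proof.
move=> a p q; apply: val_inj.
have [x [Fx ->]] := gr_of_surj p; have [y [Fy ->]] := gr_of_surj q.
have -> : a *: gr_of Fx + gr_of Fy = gr_of (submod_memL a Fx Fy).
  rewrite /gr_of /gr_class -(linearP (qclass (qfil_pred F I d))).
  by congr qclass; apply: val_inj; rewrite linearP /= linearP.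
apply: etrans (gr_phi_of _) _; rewrite linearP; apply: esym.
apply: etrans (linearP val a _ _) _.
exact: (congr2 (fun u v => a *: u + v) (gr_phi_of Fx) (gr_phi_of Fy)).
Qed.
HB.instance Definition _ d :=
  GRing.isLinear.Build k (gr_piece F I d) (hpiece D d) _ (@gr_phi d)
    (@gr_phi_is_linear d).

Lemma gr_phi_bij d : bijective (@gr_phi d).
Proof.
have inj : injective (@gr_phi d).
  move=> p q /(congr1 val); have [x [Fx ->]] := gr_of_surj p.
  by have [y [Fy ->]] := gr_of_surj q; rewrite !gr_phi_of => /gr_of_eq.
have surj (b : hpiece D d) : exists q, gr_phi q = b.
  have [x Fx xb] := sigma_surj (submod_type_mem b).
  by exists (gr_of Fx); apply: val_inj; rewrite gr_phi_of.
pose inv b := projT1 (cid (surj b)).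
have invK : cancel inv (@gr_phi d) by move=> b; rewrite /inv; case: cid.
by exists inv => // q; apply: inj; rewrite invK.
Qed.

(** Maps from the filtration pieces of A onto the homogeneous pieces of B which
    are multiplicative and whose kernels are exactly the elements of the ideal
    up to lower degree identify the associated graded algebra of A/I with B. *)
Theorem graded_iso_of_symbol : graded_iso (gr F I) (graded_of D).
Proof.
exists (fun d => @gr_phi d : {linear gr_piece F I d -> hpiece D d}).
split=> [d||i j p q]; first exact: gr_phi_bij.
  apply: val_inj; rewrite /= -[RHS]sigma1.
  have -> : gr_one F I = gr_of (fil1 F) by congr gr_class; exact: Prop_irrelevance.
  exact: gr_phi_of.
apply: val_inj; rewrite /=.
have [x [Fx ->]] := gr_of_surj p; have [y [Fy ->]] := gr_of_surj q.
have -> : gr_mul (gr_of Fx) (gr_of Fy) = gr_of (filM Fx Fy).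
  rewrite gr_mulE; apply: (congr1 (qclass (qfil_pred F I (i + j)))).
  apply: val_inj => /=.
  exact: esym (rmorphM _ _ _).
apply: etrans (gr_phi_of _) _; rewrite sigmaM //; apply: esym.
exact: (congr2 *%R (gr_phi_of Fx) (gr_phi_of Fy)).
Qed.

End GradedIso.

(** * Words modulo lower filtration degree *)
Section WordsModuloLower.
Context {k : fieldType} {A : algType k} (F : filtration A) (I : ideal2 A).
Local Notation low := (low_mod F I).

Lemma low_mod0 d : low d 0.
Proof.
case: d => [|d] /=; first exact: submod_mem0.
by exists 0; [exact: submod_mem0|rewrite subr0; exact: submod_mem0].
Qed.

Lemma low_modL d a x y : low d x -> low d y -> low d (a *: x + y).
Proof.
case: d => [|d] /=; first exact: submod_memL.
move=> [x' Fx Ix] [y' Fy Iy]; exists (a *: x' + y'); first exact: submod_memL.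
by rewrite lincombB; exact: submod_memL.
Qed.

Lemma low_modD d x y : low d x -> low d y -> low d (x + y).
Proof. by move=> lx ly; rewrite -[x]scale1r; exact: low_modL. Qed.

Lemma low_mod_fil d x : F d x -> low d.+1 x.
Proof. by move=> Fx; exists x => //; rewrite subrr; exact: submod_mem0. Qed.

Lemma low_modMl d a x : F 1 a -> low d x -> low d.+1 (a * x).
Proof.
move=> Fa; case: d => [Ix|d [y Fy Ixy]].
  exists 0; first exact: submod_mem0.
  by rewrite subr0; exact: ideal2Ml.
exists (a * y); first by rewrite -add1n; exact: filM.
by rewrite -mulrBr; exact: ideal2Ml.
Qed.

Lemma low_modMr d a x : F 0 a -> low d x -> low d (x * a).
Proof.
move=> Fa; case: d => [|d [y Fy Ixy]]; first exact: ideal2Mr.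
exists (y * a); first by rewrite -[d]addn0; exact: filM.
by rewrite -mulrBl; exact: ideal2Mr.
Qed.

Context {J : eqType} (E : J -> A).
Hypothesis FE : forall i, F 1 (E i).
Hypothesis Ecomm : forall i j, exists2 z, F 1 z & I (E i * E j - E j * E i - z).
Local Notation wE s := (\prod_(i <- s) E i).

Lemma fil_wordE s : F (size s) (wE s).
Proof.
elim: s => [|i s IHs]; first by rewrite big_nil; exact: fil1.
by rewrite big_cons /= -add1n; exact: filM.
Qed.

Arguments low_mod : simpl never.

(** Exchanging two letters at the head of a word changes it by an element of
    the ideal and a word one letter shorter. *)
Lemma low_mod_swap i j s : low (size s).+2 (wE (i :: j :: s) - wE (j :: i :: s)).
Proof.
rewrite !big_cons; have [z Fz Iz] := Ecomm i j.
exists (z * wE s); first by rewrite -add1n; apply: filM => //; exact: fil_wordE.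
by rewrite !mulrA -!mulrBl; exact: ideal2Mr.
Qed.

Lemma low_mod_move i s s' :
  low (size (s ++ s')).+1 (wE (i :: s ++ s') - wE (s ++ i :: s')).
Proof.
elim: s => [|j s IHs] /=; first by rewrite subrr; exact: low_mod0.
rewrite -[X in low _ X](subrKA (wE (j :: i :: s ++ s'))).
apply: low_modD; first exact: low_mod_swap.
by rewrite 2!(big_cons _ _ j) -mulrBr; exact: low_modMl.
Qed.

(** Permutations are generated by such exchanges: bring the first letter of the
    one word to the front of the other and use induction on the rest. *)
Lemma low_mod_perm s s' : perm_eq s s' -> low (size s) (wE s - wE s').
Proof.
elim: s s' => [|i s IHs] s'.
  by rewrite perm_sym => /perm_nilP ->; rewrite subrr; exact: low_mod0.
move=> ps; have : i \in s' by rewrite -(perm_mem ps) mem_head.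
move=> is'; case/splitPr: is' ps => s1 s2 ps.
have {}ps : perm_eq s (s1 ++ s2).
  by rewrite -(perm_cons i) (perm_trans ps) // -cat1s perm_catCA.
rewrite -(subrKA (wE (i :: s1 ++ s2))) /= -[wE (i :: s)]/(wE (i :: s)).
apply: low_modD; last by rewrite (perm_size ps); exact: low_mod_move.
by rewrite !big_cons -mulrBr; exact: low_modMl (IHs _ ps).
Qed.

End WordsModuloLower.

(** * The symbol map from T(V)#G to S#G *)
Section SkewSymbolMap.
Context {gT : finGroupType} {k : fieldType} {V : vectType k}.
Variable rho : linrep gT V.
Local Notation n := (\dim {:V}).
Local Notation F := (tenskew_filtration rho).
Local Notation D := (symskew_grading rho).

Definition sym_part d : symalg V -> symalg V := pihomog mdeg d.
HB.instance Definition _ d := GRing.Linear.on (sym_part d).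

Lemma sym_part_hom d s : sym_hom V d (sym_part d s).
Proof. exact: pihomogP. Qed.

Lemma msize_sym_act g d (s : symalg V) :
  (msize (s : mpoly n k) <= d)%N -> (msize (sym_gaction rho g s : mpoly n k) <= d)%N.
Proof.
apply: msize_comp_mpoly => i; rewrite tnth_mktuple.
exact: msize_homog (sym_hom_symv _).
Qed.

(** G preserves degrees, so it commutes with taking the part of top degree. *)
Lemma sym_part_act g d (s : symalg V) : (msize (s : mpoly n k) <= d.+1)%N ->
  sym_part d (sym_gaction rho g s) = sym_gaction rho g (sym_part d s).
Proof.
move=> sd; have /(msize_sym_act g) r := msize_sub_pihomog sd.
have rE : sym_gaction rho g (s - sym_part d s) =
    sym_gaction rho g s - sym_gaction rho g (sym_part d s) by exact: raddfB.
have : sym_part d (sym_gaction rho g s - sym_gaction rho g (sym_part d s)) = 0.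
  by rewrite -rE; exact: pihomog_small.
rewrite raddfB => /eqP; rewrite subr_eq0 => /eqP ->.
have h : (sym_gaction rho g (sym_part d s) : mpoly n k) \is d.-homog.
  exact: (@sym_act_hom _ _ _ rho d g _ (sym_part_hom d s)).
exact: pihomog_dE h.
Qed.

(** The part of degree d of the image in S#G. *)
Definition symbol d (x : tenskew rho) : symskew rho :=
  skew_of (sym_gaction rho) (fun g => sym_part d (skew_fun (skew_sym x) g)).

Lemma symbolE d x g :
  skew_fun (symbol d x) g = sym_part d (skew_fun (skew_sym x) g).
Proof. exact: skew_ofE. Qed.

Fact symbol_is_linear d : linear (symbol d).
Proof.
move=> a x y; apply: skewP => g; rewrite skewDE skewZE !symbolE.
rewrite -linearP -skewZE -skewDE; congr (sym_part d (skew_fun _ g)).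
exact: skew_sym_is_linear.
Qed.
HB.instance Definition _ d :=
  GRing.isLinear.Build k (tenskew rho) (symskew rho) _ (symbol d)
    (symbol_is_linear d).

Lemma msize_skew_sym d x g : F d x ->
  (msize (skew_fun (skew_sym x) g : mpoly n k) <= d.+1)%N.
Proof. by move=> Fx; rewrite skew_symE; apply: msize_ten_sym; exact: Fx. Qed.

Lemma symbol_hom d x : F d x -> D d (symbol d x).
Proof. by move=> _ g; rewrite symbolE; exact: sym_part_hom. Qed.

Lemma skew_sym1 : skew_sym (1 : tenskew rho) = 1.
Proof.
apply: skewP => g; rewrite skew_symE [skew_fun 1 g]skew_ofE [RHS]skew_ofE.
by case: ifP => _; [exact: rmorph1|exact: raddf0].
Qed.

Lemma symbol1 : symbol 0 1 = 1.
Proof.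
apply: skewP => g; rewrite symbolE skew_sym1 [skew_fun 1 g]skew_ofE.
case: ifP => _; last exact: raddf0.
by apply: pihomog_dE; exact: dhomog1.
Qed.

Lemma symbolM i j x y : F i x -> F j y ->
  symbol (i + j)%N (x * y) = symbol i x * symbol j y.
Proof.
move=> Fx Fy; apply: skewP => g; rewrite symbolE skew_symM !skewME raddf_sum.
apply: eq_bigr => h _; rewrite !symbolE -sym_part_act; last exact: msize_skew_sym.
apply: pihomogM; first exact: msize_skew_sym.
exact/msize_sym_act/msize_skew_sym.
Qed.

Lemma symbol_low d x : F d x -> symbol d.+1 x = 0.
Proof.
move=> Fx; apply: skewP => g; rewrite symbolE [RHS]ffunE.
exact/pihomog_small/msize_skew_sym.
Qed.

Lemma symbol_eq0 d x : (forall g, (msize (skew_fun (skew_sym x) g : mpoly n k) <= d)%N) ->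
  symbol d x = 0.
Proof.
move=> xd; apply: skewP => g; rewrite symbolE [RHS]ffunE.
exact: pihomog_small.
Qed.

(** The section of T(V) -> S(V), coefficientwise.  It lifts elements of S#G, and
    an element of T(V)#G differs from the lift of its image only by reordering
    the letters of its words. *)
Definition skew_sec (s : symskew rho) : tenskew rho :=
  skew_of (ten_gaction rho) (fun g => sym_sec (skew_fun s g)).

Lemma skew_secE s g : skew_fun (skew_sec s) g = sym_sec (skew_fun s g).
Proof. exact: skew_ofE. Qed.

Lemma skew_sec_fil d s : (forall g, (msize (skew_fun s g : mpoly n k) <= d.+1)%N) ->
  F d (skew_sec s).
Proof. by move=> sd g; rewrite skew_secE; apply: sym_sec_fil; exact: sd. Qed.

Lemma symbol_surj d b : D d b -> exists2 x, F d x & symbol d x = b.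
Proof.
move=> Db; have bd g := msize_homog (Db g).
exists (skew_sec b); first exact: skew_sec_fil.
apply: skewP => g; rewrite symbolE skew_symE skew_secE.
exact: etrans (congr1 (sym_part d) (sym_secK _)) (pihomog_dE (Db g)).
Qed.

Variable kappa : {ffun 'I_2 -> V} -> {ffun gT -> k^o * V}.
Local Notation I := (orbifold_ideal rho kappa).
Local Notation low := (low_mod F I).

Lemma vec_elt_fil v : F 1 (vec_elt rho v).
Proof. by apply: skew_elt_coef; exact: ten_fil_tenv. Qed.

Lemma kappa_elt_fil x : F 1 (kappa_elt rho x).
Proof.
move=> g; rewrite skew_ofE; apply: ten_filL; last exact: ten_fil_tenv.
exact/ten_fil_mono/ten_fil1.
Qed.

(** The relations say that the letters commute up to filtration degree 1. *)
Lemma vec_elt_comm i j : exists2 z, F 1 z &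
  I (vec_elt rho (vbase i) * vec_elt rho (vbase j)
     - vec_elt rho (vbase j) * vec_elt rho (vbase i) - z).
Proof.
exists (kappa_elt rho (kappa (pair2 (vbase i) (vbase j)))).
  exact: kappa_elt_fil.
by apply: mem_ideal_gen; exists (vbase i), (vbase j).
Qed.

Lemma prod_vec_elt (s : seq 'I_n) :
  \prod_(i <- s) vec_elt rho (vbase i) = skew_elt (ten_gaction rho) (word s) 1%g.
Proof.
elim: s => [|i s IHs]; first by rewrite /word !big_nil.
rewrite big_cons IHs; apply: etrans (skew_eltM _ _ _ _ _) _; rewrite mulg1.
apply: (congr1 (fun a => skew_elt (ten_gaction rho) a 1%g)).
rewrite word_cons -tenv_base; apply: (congr1 ( *%R _)).
exact: Defs.gact1.
Qed.

(** A group element to the right of a word does not interfere with reordering. *)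
Lemma low_word_perm (s s' : seq 'I_n) g : perm_eq s s' -> low (size s)
  (skew_elt (ten_gaction rho) (word s) g - skew_elt (ten_gaction rho) (word s') g).
Proof.
have eltg (x : tenalg V) : skew_elt (ten_gaction rho) x g =
    skew_elt (ten_gaction rho) x 1%g * skew_elt (ten_gaction rho) 1 g.
  apply: esym; apply: etrans (skew_eltM _ _ _ _ _) _; rewrite mul1g.
  apply: (congr1 (fun a => skew_elt (ten_gaction rho) a g)).
  by rewrite rmorph1; exact: mulr1.
move=> ps; rewrite (eltg (word s)) (eltg (word s')) -!prod_vec_elt -mulrBl.
apply: low_modMr; first by apply: skew_elt_coef; exact: ten_fil1.
by apply: low_mod_perm => //; [move=> i; exact: vec_elt_fil|exact: vec_elt_comm].
Qed.

(** What reordering the words of [x] leaves over. *)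
Definition sec_rest (x : tenalg V) : tenalg V := x - sym_sec (ten_sym x).

Lemma sec_rest0 : sec_rest 0 = 0.
Proof.
have s0 : sym_sec (ten_sym (0 : tenalg V)) = 0.
  by apply: etrans (congr1 sym_sec (raddf0 ten_sym)) _; exact: raddf0.
by rewrite /sec_rest s0 subrr.
Qed.

Lemma sec_restL a x y : sec_rest (a *: x + y) = a *: sec_rest x + sec_rest y.
Proof.
rewrite /sec_rest.
have -> : sym_sec (ten_sym (a *: x + y)) = a *: sym_sec (ten_sym x) + sym_sec (ten_sym y).
  by apply: etrans (congr1 sym_sec (ten_symL a x y)) _; exact: sym_secL.
exact: lincombB.
Qed.

Lemma sec_rest_word (s : seq 'I_n) : sec_rest (word s) = word s - word (m2s (s2m s)).
Proof.
apply: (congr1 (fun z => word s - z)).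
exact: etrans (congr1 sym_sec (ten_sym_word s)) (sym_secX _).
Qed.

Lemma low_sec_rest d x g : ten_fil V d x ->
  low d (skew_elt (ten_gaction rho) (sec_rest x) g).
Proof.
have eL a u v : skew_elt (ten_gaction rho) (a *: u + v) g =
    a *: skew_elt (ten_gaction rho) u g + skew_elt (ten_gaction rho) v g.
  exact: skew_elt_is_linear.
have eB u v : skew_elt (ten_gaction rho) (u - v) g =
    skew_elt (ten_gaction rho) u g - skew_elt (ten_gaction rho) v g.
  by have := eL (-1) v u; rewrite !scaleN1r addrC [X in _ = X -> _]addrC.
move: x; apply: ten_word_ind => [|a x y lx ly|s sd].
- rewrite sec_rest0; have -> : skew_elt (ten_gaction rho) 0 g = 0.
    by rewrite -(subrr (0 : tenalg V)) eB subrr.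
  exact: low_mod0.
- by rewrite sec_restL eL; exact: low_modL.
rewrite sec_rest_word eB; move: sd; rewrite leq_eqVlt => /orP[/eqP <-|].
  by apply: low_word_perm; exact: perm_m2s.
case: d => // d; rewrite ltnS => sd; apply: low_mod_fil.
have Fw (s' : seq 'I_n) : (size s' <= d)%N ->
    F d (skew_elt (ten_gaction rho) (word s') g).
  by move=> s'd; apply: skew_elt_coef; exact: ten_fil_word.
rewrite -scaleN1r addrC; apply: submod_memL; apply: Fw => //.
by rewrite -(perm_size (perm_m2s s)).
Qed.

Lemma low_sub_sec d x : F d x -> low d (x - skew_sec (skew_sym x)).
Proof.
move=> Fx.
have -> : x - skew_sec (skew_sym x) =
    \sum_g skew_elt (ten_gaction rho) (sec_rest (skew_fun x g)) g.
  apply: etrans (skewE _) _; apply: eq_bigr => g _.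
  apply: (congr1 (fun a => skew_elt (ten_gaction rho) a g)).
  by apply: etrans (skewDE _ _ _) _; rewrite skewNE skew_secE skew_symE.
apply: (big_ind (low d)) => [|y z|g _]; [exact: low_mod0|exact: low_modD|].
exact: low_sec_rest (Fx g).
Qed.

(** The image in S#G of an element with zero symbol has smaller degree, and then
    so has its lift. *)
Lemma symbol_ker d x : F d x -> symbol d x = 0 -> low d x.
Proof.
move=> Fx x0; rewrite -(subrK (skew_sec (skew_sym x)) x).
apply: low_modD; first exact: low_sub_sec.
have small g : (msize (skew_fun (skew_sym x) g : mpoly n k) <= d)%N.
  have := msize_sub_pihomog (msize_skew_sym g Fx).
  have -> : pihomog mdeg d (skew_fun (skew_sym x) g : mpoly n k) = 0.
    have := congr1 (fun y : symskew rho => skew_fun y g) x0.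
    by rewrite symbolE [skew_fun 0 g]ffunE.
  by rewrite subr0.
case: d {x0 Fx} small => [|d] small; last by apply/low_mod_fil/skew_sec_fil.
have -> : skew_sec (skew_sym x) = 0; last exact: low_mod0.
apply: skewP => g; rewrite skew_secE [RHS]ffunE.
have /eqP -> : skew_fun (skew_sym x) g == 0.
  by rewrite -(mmeasure_poly_eq0 mdeg) -leqn0 small.
exact: raddf0.
Qed.

(** The PBW condition reduces to one statement on the ideal of relations: it
    contains no element of filtration degree d with a nonzero part of degree d
    in S#G.  All other properties of the symbol hold for every kappa. *)
Theorem drinfeld_of_symbol :
    (forall d x, F d x -> I x ->
      forall g, (msize (skew_fun (skew_sym x) g : mpoly n k) <= d)%N) ->
  drinfeld_orbifold_algebra rho kappa.
Proof.
move=> small; apply: (graded_iso_of_symbol (sigma := fun d => symbol d)) => //.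
- exact: symbol_hom.
- exact: symbol1.
- exact: symbolM.
- exact: symbol_surj.
- exact: symbol_low.
- by move=> d x Fx Ix; apply: symbol_eq0; exact: small.
- exact: symbol_ker.
Qed.

End SkewSymbolMap.

(** * Simultaneous eigenbases of abelian groups *)
Section FiniteOrder.
Context {F : fieldType}.

(** The minimal polynomial divides X^N - 1, which is separable when N is
    invertible, and it splits because the characteristic polynomial does.  The
    power is written as an iterated product since square matrices only form a
    ring in positive size. *)
Lemma finite_order_diagonalizable n (A : 'M[F]_n) N rs :
    (N%:R : F) != 0 -> iter N (mulmx A) 1%:M = 1%:M ->
    char_poly A = \prod_(a <- rs) ('X - a%:P) ->
  diagonalizable A.
Proof.
case: n A => [|n] A N0 AN cA.
  by rewrite (thinmx0 A) -(thinmx0 0); exact: diagonalizable0.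
have {}AN : A ^+ N = 1.
  have iterE m : iter m (mulmx A) 1%:M = A ^+ m.
    by elim: m => [|m IHm]; rewrite ?expr0 // exprS iterS IHm.
  by rewrite -iterE AN.
have dvdX : mxminpoly A %| 'X^N - 1.
  by apply: mxminpoly_min; rewrite rmorphB rmorphXn rmorph1 /= horner_mx_X AN subrr.
have := mxminpoly_dvd_char A; rewrite cA => /dvdp_prod_XsubC[m mE].
have sep := dvdp_separable dvdX (separable_Xn_sub_1 N0).
apply/diagonalizableP; exists (mask m rs); last by rewrite (eqp_dvdl _ mE).
by rewrite -separable_prod_XsubC -(eqp_separable mE).
Qed.

End FiniteOrder.

Import passmx.

Section Eigenbasis.
Context {gT : finGroupType} {k : fieldType} {V : vectType k}.
Variable rho : linrep gT V.
Local Notation n := (\dim {:V}).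

Definition rep_mx (g : gT) : 'M[k]_n :=
  mxof (vbasis {:V}) (vbasis {:V}) (rho g).

(** Matrices act on row vectors from the right, whence the reversed order. *)
Lemma rep_mxM g h : rep_mx (g * h)%g = rep_mx h *m rep_mx g.
Proof.
rewrite /rep_mx lrepM.
exact: (mxof_comp _ _ (vbasisP {:V}) (rho h) (rho g)).
Qed.

Lemma rep_mx1 : rep_mx 1%g = 1%:M.
Proof. by rewrite /rep_mx lrep1 mxof1 //; apply: basis_free (vbasisP _). Qed.

Lemma rep_mx_iter g m : iter m (mulmx (rep_mx g)) 1%:M = rep_mx (g ^+ m)%g.
Proof.
elim: m => [|m IHm]; first by rewrite rep_mx1.
by rewrite iterS IHm expgSr rep_mxM.
Qed.

(** Commuting diagonalizable matrices are diagonalized by one matrix, whose rows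
    are the coordinates of the eigenbasis. *)
Theorem eigenbasis_exists :
    (#|gT|%:R : k) \is a GRing.unit -> has_all_eigenvalues rho ->
    abelian [set: gT] ->
  exists (e : n.-tuple V) (lam : gT -> 'I_n -> k),
    basis_of fullv e /\ forall g (i : 'I_n), rho g e`_i = lam g i *: e`_i.
Proof.
move=> unitG eig abG.
have [P Pu /allP Pdiag] : codiagonalizable [seq rep_mx g | g : gT].
  apply/codiagonalizableP; split=> [_ _ /codomP[g ->] /codomP[h ->]|_ /codomP[g ->]].
    rewrite /comm_mx -!rep_mxM; congr rep_mx.
    by apply: (centsP abG); rewrite inE.
  have [rs cE] := eig g.
  apply: (finite_order_diagonalizable (N := #|gT|) _ _ cE); first by rewrite -unitfE.
  by rewrite rep_mx_iter -cardsT expg_cardG ?inE // rep_mx1.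
pose e := [tuple vecof (vbasis {:V}) (row i P) | i < n].
have eE (i : 'I_n) : e`_i = vecof (vbasis {:V}) (row i P).
  by rewrite -tnth_nth tnth_mktuple.
have B := vbasisP {:V}.
(* The eigenvalues are the diagonal entries of the diagonalized matrices. *)
exists e, (fun g i => (P *m rep_mx g *m invmx P) i i); split=> [|g i].
  rewrite basisEfree subvf size_tuple leqnn andbT andbT.
  apply/freeP => a a0 i.
  have /eqP : vecof (vbasis {:V}) (\sum_i a i *: row i P) = 0.
    by rewrite -[RHS]a0 linear_sum; apply: eq_bigr => j _; rewrite eE linearZ.
  rewrite vecof_eq0 // => /eqP aP0.
  have : (\row_j a j) *m P = 0.
    by rewrite mulmx_sum_row -[RHS]aP0; apply: eq_bigr => j _; rewrite mxE.
  move=> /(congr1 (mulmx^~ (invmx P))); rewrite mulmxK // mul0mx => /rowP/(_ i).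
  by rewrite !mxE.
have /Pdiag /= : rep_mx g \in [seq rep_mx g | g : gT] by apply: codom_f.
move=> /(diagonalizable_forP _ Pu) dg.
have rhoE u : rho g (vecof (vbasis {:V}) u) = vecof (vbasis {:V}) (u *m rep_mx g).
  exact: hom_vecof B (rho g) u.
rewrite eE rhoE -linearZ; congr vecof.
have -> : row i P *m rep_mx g = row i (P *m rep_mx g *m invmx P) *m P.
  by rewrite -!row_mul mulmxKV.
apply/rowP => j; rewrite 2!mxE (bigD1 i) //= big1 ?addr0 => [|l li].
  by rewrite !mxE.
by rewrite [X in X * _]mxE dg ?mul0r // eq_sym.
Qed.

End Eigenbasis.

(** * Linear cochains and sums over Alt_3 *)
Section LinearCochain.
Context {gT : finGroupType} {k : fieldType} {V : vectType k}.
Variable rho : linrep gT V.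
Local Notation n := (\dim {:V}).

(** The coefficients of the variables recover the vector. *)
Lemma symv_inj : injective (@symv k V).
Proof.
move=> v w vw; rewrite (vcoordE v) (vcoordE w); apply: eq_bigr => i _.
have symv_coef u : mpoly.mcoeff U_(i)%MM (symv u : mpoly n k) = vcoord i u.
  rewrite /symv raddf_sum (bigD1 i) //= big1 ?addr0 => [|j ji].
    by rewrite mcoeffZ mcoeffX eqxx mulr1.
  rewrite mcoeffZ mcoeffX; case: eqP => [/mnmP/(_ i)|]; last by rewrite mulr0.
  by rewrite !mnm1E eqxx (negPf ji).
by rewrite -!symv_coef vw.
Qed.

Lemma in_sym_fix_act g s : in_sym_fix rho g s -> sym_gaction rho g s = s.
Proof.
move=> [q ->]; move: q; apply: mpoly_linT_ind => [|a p q IHp IHq|m].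
- by rewrite !raddf0.
- by rewrite !linearP /= IHp IHq.
rewrite comp_mpolyX rmorph_prod; apply: eq_bigr => i _.
rewrite rmorphXn /= tnth_mktuple; congr (_ ^+ _).
apply: etrans (sym_actv rho g _) _; congr symv.
by apply/fixedSpaceP/vbasis_mem/mem_nth; rewrite size_tuple.
Qed.

End LinearCochain.

Section Alt3.
Context {W : nmodType}.

(** Alt_3 consists of the powers of the cyclic shift, which is even because its
    cube is the identity. *)
Lemma sum_Alt3 (f : 'I_3 -> 'I_3 -> 'I_3 -> W) :
  \sum_(s in ('Alt_('I_3))%g) f (s 0) (s 1) (s 2) =
  f 0 1 2 + (f 1 2 0 + f 2 0 1).
Proof.
have inj3 : injective (@ordS 3) by exact: can_inj (@ordSK 3).
pose c := perm inj3.
have cc : (c * c * c = 1)%g.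
  apply/permP => i; rewrite !permM !permE; apply/val_inj => /=.
  by case: i => [[|[|[|//]]]].
have cE : odd_perm c = false.
  have := congr1 (@odd_perm _) cc.
  by rewrite !odd_permM odd_perm1; case: (odd_perm c).
have c1 : c != 1%g by apply/eqP => /permP/(_ 0)/(congr1 val); rewrite !permE.
have c2 : (c * c != 1)%g.
  by apply/eqP => /permP/(_ 0)/(congr1 val); rewrite permM !permE.
have c3 : (c * c != c)%g by rewrite eq_mulgV1 mulgK.
have -> : ('Alt_('I_3))%g = 1%g |: (c |: [set (c * c)%g]).
  apply/eqP; rewrite eq_sym eqEcard; apply/andP; split.
    apply/subsetP => s; rewrite 2!in_setU1 in_set1 => /or3P[] /eqP ->;
      by rewrite Alt_even ?odd_permM ?odd_perm1 ?cE.
  have : (2 * #|('Alt_('I_3))%g| = 6)%N by rewrite card_Alt card_ord.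
  rewrite !cardsU1 cards1 !inE negb_or eq_sym c1 eq_sym c2 eq_sym c3 /=; lia.
rewrite big_setU1 ?inE ?negb_or 1?eq_sym ?c1 1?eq_sym ?c2 //.
rewrite big_setU1 ?inE 1?eq_sym ?c3 // big_set1 !permM !perm1 !permE.
by congr (f _ _ _ + (f _ _ _ + f _ _ _)); apply: val_inj.
Qed.

End Alt3.

(** * Structure constants of an invariant cochain in H^2 *)
Section StructureConstants.
Context {gT : finGroupType} {k : fieldType} {V : vectType k}.
Variable rho : linrep gT V.
Local Notation n := (\dim {:V}).
Variables (e : n.-tuple V) (lam : gT -> 'I_n -> k).
Hypothesis eB : basis_of fullv e.
Hypothesis elam : forall g (i : 'I_n), rho g e`_i = lam g i *: e`_i.
Variable kL : {ffun 'I_2 -> V} -> {ffun gT -> V}.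
Hypothesis kL_alt : alternating kL.
Hypothesis kL_H : in_H (lin_cochain rho kL).
Hypothesis kL_G : G_invariant (lin_cochain rho kL).
Hypothesis abG : abelian [set: gT].

Definition kap g v w : V := kL (pair2 v w) g.

Lemma ord2P (i : 'I_2) : i = 0 \/ i = 1.
Proof. by case: i => [[|[|i]] h] //; [left|right]; apply: val_inj. Qed.

Lemma kapLl g a x y w : kap g (a *: x + y) w = a *: kap g x w + kap g y w.
Proof.
have pE z : pair2 z w = vupd (pair2 0 w) 0 z.
  by apply/ffunP => i; rewrite !ffunE; case: eqP.
by rewrite /kap; have := kL_alt.1 0 (pair2 0 w) a x y; rewrite -!pE => ->; rewrite !ffunE.
Qed.

Lemma kapLr g a v x y : kap g v (a *: x + y) = a *: kap g v x + kap g v y.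
Proof.
have pE z : pair2 v z = vupd (pair2 v 0) 1 z.
  by apply/ffunP => i; rewrite !ffunE; case: (ord2P i) => ->.
by rewrite /kap; have := kL_alt.1 1 (pair2 v 0) a x y; rewrite -!pE => ->; rewrite !ffunE.
Qed.

Lemma kapxx g v : kap g v v = 0.
Proof. by rewrite /kap (kL_alt.2 _ 0 1) ?ffunE. Qed.

Lemma kapDl g x y w : kap g (x + y) w = kap g x w + kap g y w.
Proof. by have := kapLl g 1 x y w; rewrite !scale1r. Qed.

Lemma kapDr g v x y : kap g v (x + y) = kap g v x + kap g v y.
Proof. by have := kapLr g 1 v x y; rewrite !scale1r. Qed.

Lemma kap0l g w : kap g 0 w = 0.
Proof. by have := kapLl g (-1) 0 0 w; rewrite scaler0 addr0 scaleN1r addNr. Qed.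

Lemma kap0r g v : kap g v 0 = 0.
Proof. by have := kapLr g (-1) v 0 0; rewrite scaler0 addr0 scaleN1r addNr. Qed.

Lemma kapZl g a x w : kap g (a *: x) w = a *: kap g x w.
Proof. by have := kapLl g a x 0 w; rewrite kap0l !addr0. Qed.

Lemma kapZr g a v x : kap g v (a *: x) = a *: kap g v x.
Proof. by have := kapLr g a v x 0; rewrite kap0r !addr0. Qed.

Lemma kapC g v w : kap g v w = - kap g w v.
Proof.
have := kapxx g (v + w); rewrite kapDl !kapDr !kapxx add0r addr0 => /eqP.
by rewrite addr_eq0 => /eqP.
Qed.

Lemma kap_suml g (I : finType) (a : I -> k) (x : I -> V) w :
  kap g (\sum_i a i *: x i) w = \sum_i a i *: kap g (x i) w.
Proof.
rewrite (big_morph (kap g ^~ w) (fun x y => kapDl g x y w) (kap0l g w)).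
by apply: eq_bigr => i _; rewrite kapZl.
Qed.

Lemma kap_sumr g (I : finType) (a : I -> k) (x : I -> V) v :
  kap g v (\sum_i a i *: x i) = \sum_i a i *: kap g v (x i).
Proof.
rewrite (big_morph (kap g v) (kapDr g v) (kap0r g v)).
by apply: eq_bigr => i _; rewrite kapZr.
Qed.

Definition stc g (i j p : 'I_n) : k := coord e p (kap g e`_i e`_j).

Lemma stcC g i j p : stc g j i p = - stc g i j p.
Proof. by rewrite /stc kapC raddfN. Qed.

Lemma stcxx g i p : stc g i i p = 0.
Proof. by rewrite /stc kapxx raddf0. Qed.

Lemma coord_kap v w g p : coord e p (kap g v w) =
  \sum_i \sum_j coord e i v * coord e j w * stc g i j p.
Proof.
rewrite [v in LHS](coord_sumE eB) kap_suml linear_sum; apply: eq_bigr => i _.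
rewrite linearZ [w in LHS](coord_sumE eB) kap_sumr linear_sum /= mulr_sumr.
by apply: eq_bigr => j _; rewrite linearZ /= mulrA.
Qed.

(** As G is abelian, conjugation does not permute the coefficients of a cochain,
    so invariance concerns each of them separately. *)
Lemma kap_equivariant g h v w : rho h (kap g v w) = kap g (rho h v) (rho h w).
Proof.
apply: symv_inj.
have hK x : rho h^-1%g (rho h x) = x.
  by have := lrepM rho h^-1%g h; rewrite mulVg lrep1 => /lfunP/(_ x); rewrite !lfunE.
have := congr1 (fun x : symskew rho => skew_fun x g) (kL_G h (pair2 (rho h v) (rho h w))).
rewrite /cochain_act /skew_conj /lin_cochain !skew_ofE -[RHS]/(symv (kap g _ _)) => <-.
have -> : (h^-1 * g * h)%g = g.
  by rewrite -mulgA (centsP abG g _ h) ?inE // mulKg.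
rewrite [RHS]sym_actv; congr (symv (rho h (kL _ g))).
by apply/ffunP => i; rewrite !ffunE; case: ifP; rewrite hK.
Qed.

Lemma stc_weight g h i j p :
  stc g i j p * lam h p = stc g i j p * (lam h i * lam h j).
Proof.
have := congr1 (coord e p) (kap_equivariant g h e`_i e`_j).
rewrite (coord_rho eB elam) !elam kapZl kapZr !linearZ /= -/(stc g i j p) => e1.
by rewrite mulrC e1; ring.
Qed.

(** The polynomial factors of the generators of H^2 at g lie in S(V^g). *)
Lemma kap_fixed g v w : rho g (kap g v w) = kap g v w.
Proof.
apply: symv_inj; rewrite -sym_actv.
have [m [gs [gens [gensH kLE]]]] := kL_H.
have -> : symv (kap g v w) = \sum_t skew_fun (gens t (pair2 v w)) g.
  have := congr1 (fun x : symskew rho => skew_fun x g) (kLE (pair2 v w)).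
  rewrite /lin_cochain skew_ofE => ->.
  by rewrite /skew_fun sum_ffunE.
apply: etrans (raddf_sum _ _ _ _) _; apply: eq_bigr => t _.
have [s [l [sfix _ _ _ ->]]] := gensH t; rewrite skew_ofE.
case: ifP => [/eqP ->|_]; last exact: raddf0.
by apply: etrans (linearZ _ _) _; congr (_ *: _); exact: in_sym_fix_act.
Qed.

Lemma stc_fixed g i j p : stc g i j p != 0 -> lam g p = 1.
Proof.
move=> c0; have := congr1 (coord e p) (kap_fixed g e`_i e`_j).
rewrite (coord_rho eB elam) -/(stc g i j p) -[RHS]mul1r => /eqP.
by rewrite (inj_eq (mulIf c0)) => /eqP.
Qed.

(** V^g is spanned by the eigenvectors of eigenvalue 1. *)
Lemma card_moved_codim g : (#|[set i | lam g i != 1%R]| <= codim_fix rho g)%N.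
Proof.
rewrite /codim_fix; pose A := [set i | lam g i == 1].
have -> : [set i | lam g i != 1] = ~: A by apply/setP => i; rewrite !inE.
rewrite cardsCs setCK card_ord leq_sub2l //.
apply: (@leq_trans (\dim <<[seq e`_(val i) | i <- enum A]>>%VS)).
  apply/dimvS/subvP => v /fixedSpaceP gv.
  rewrite (coord_sumE eB v); apply: memv_suml => i _; have [iA|iA] := boolP (i \in A).
    apply/memvZ/memv_span/mapP; exists i => //; by rewrite mem_enum.
  have := congr1 (coord e i) gv; rewrite (coord_rho eB elam) -[RHS]mul1r => /eqP.
  rewrite -subr_eq0 -mulrBl mulf_eq0 subr_eq0; move: iA; rewrite inE => /negPf -> /=.
  by move=> /eqP ->; rewrite scale0r mem0v.
by apply: leq_trans (dim_span _) _; rewrite size_map cardE.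
Qed.

Lemma fixed_in_fix g i : lam g i = 1 -> e`_i \in fix_space rho g.
Proof. by move=> gi; apply/fixedSpaceP; rewrite elam gi scale1r. Qed.

(** A nonzero value at g comes from a generator of H^2 at g with a nonzero
    exterior factor; its last codim V^g functionals vanish on V^g. *)
Lemma kap_generator g v w : kap g v w != 0 ->
  exists l : 'I_2 -> 'Hom(V, k^o), [/\ (codim_fix rho g <= 2)%N,
    forall a : 'I_2, (2 - codim_fix rho g <= a)%N ->
      forall x, x \in fix_space rho g -> l a x = 0
    & wedge l (pair2 v w) != 0].
Proof.
have [m [gs [gens [gensH kLE]]]] := kL_H.
have kapE : symv (kap g v w) = \sum_t skew_fun (gens t (pair2 v w)) g.
  have := congr1 (fun x : symskew rho => skew_fun x g) (kLE (pair2 v w)).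
  rewrite /lin_cochain skew_ofE => ->.
  by rewrite /skew_fun sum_ffunE.
move=> k0; have [t tg] : exists t, skew_fun (gens t (pair2 v w)) g != 0.
  apply/existsP; apply: contraNT k0 => /existsPn g0.
  apply/eqP/symv_inj; rewrite kapE raddf0 big1 // => t _.
  by apply/eqP; rewrite -[_ == _]negbK g0.
have [s [l [_ cod2 _ lfix gE]]] := gensH t.
move: tg; rewrite gE skew_ofE; case: ifP => [/eqP gt|_]; last by rewrite eqxx.
rewrite scaler_eq0 negb_or => /andP[w0 _].
by exists l; rewrite gt.
Qed.

(** At most codim V^g <= 2 eigenvectors are moved by g.  Suppose that e_l is one
    of them, with l different from i and j.  If the codimension is
    1, only e_l is moved, and one row of the determinant would vanish on e_i
    and e_j.  If it is 2, both functionals vanish on V^g, so e_i and e_j are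
    moved as well, and e_l would be a third moved vector. *)
Lemma stc_moved g (i j p l : 'I_n) :
  stc g i j p != 0 -> lam g l != 1 -> (l == i) || (l == j).
Proof.
move=> c0 gl; apply: contraT; rewrite negb_or => /andP[li lj].
have ij : i != j by apply: contraNneq c0 => ->; rewrite stcxx.
have k0 : kap g e`_i e`_j != 0.
  by apply: contraNneq c0 => k0; rewrite /stc k0 raddf0.
have [f [cod2 ffix w0]] := kap_generator k0.
have cardM := card_moved_codim g.
have movedP (x : 'I_n) : x \notin [set i | lam g i != 1] -> e`_x \in fix_space rho g.
  by rewrite inE negbK => /eqP; exact: fixed_in_fix.
have lM : l \in [set i | lam g i != 1] by rewrite inE.
(* The codimension is not 0, as e_l is moved. *)
have [C1|C2] := leqP (codim_fix rho g) 1.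
  have other x : l != x -> e`_x \in fix_space rho g.
    move=> lx; apply: movedP; apply: contraL cardM => xM; rewrite -ltnNge.
    apply: leq_ltn_trans C1 _; rewrite -[1%N.+1](_ : #|[set l; x]| = 2%N).
      by apply: subset_leq_card; apply/subsetP => y /set2P[] ->.
    by rewrite cards2 lx.
  case/eqP: w0; rewrite /wedge (expand_det_row _ 1) big1 // => b _.
  rewrite mxE ffix ?mul0r //; last by rewrite ffunE; case: ifP => _; exact: other.
  rewrite leq_subLR addn1 ltnS (leq_trans _ cardM) // card_gt0.
  by apply/set0Pn; exists l.
have moved x : (x == i) || (x == j) -> x \in [set i | lam g i != 1].
  move=> xij; apply: contraT => /movedP xfix; case/eqP: w0.
  have [b bx] : exists b : 'I_2, pair2 e`_i e`_j b = e`_x.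
    by case/orP: xij => /eqP ->; [exists 0|exists 1]; rewrite ffunE.
  rewrite /wedge (expand_det_col _ b) big1 // => a _.
  by rewrite mxE bx ffix ?mul0r // (eqP (_ : 2 - codim_fix rho g == 0)%N) // subn_eq0.
have : (3 <= codim_fix rho g)%N; last by rewrite ltnNge cod2.
apply: leq_trans cardM; rewrite -(_ : #|[set l; i; j]| = 3%N).
  apply: subset_leq_card; apply/subsetP => y; rewrite !inE -orbA.
  case/or3P => [/eqP->//|yi|yj]; have := moved y; rewrite inE; apply.
    by rewrite yi.
  by rewrite yj orbT.
by rewrite -setUA cardsU1 cards2 !inE negb_or li lj ij.
Qed.

Lemma stc_fix_other g (i j l p : 'I_n) : i != j -> l != i -> l != j ->
  stc g i j p * lam g l = stc g i j p.
Proof.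
move=> _ li lj; have [->|c0] := eqVneq (stc g i j p) 0; first by rewrite mul0r.
have [->|gl] := eqVneq (lam g l) 1; first by rewrite mulr1.
by have := stc_moved c0 gl; rewrite (negPf li) (negPf lj).
Qed.

(** The coefficient of g in the Jacobi expression of kL. *)
Definition jac g (x y z : V) : V := \sum_h (kap (g * h^-1)%g (kap h x y) z
  + (kap (g * h^-1)%g (kap h y z) x + kap (g * h^-1)%g (kap h z x) y)).

(** Both summands of the bracket agree, and the even permutations of three
    vectors are the cyclic rotations. *)
Lemma bracketE v g : skew_fun (bracket rho kL kL v) g =
  symv (jac g (v 0) (v 1) (v 2) + jac g (v 0) (v 1) (v 2)).
Proof.
rewrite /bracket skew_ofE; congr symv; rewrite /jac -big_split.
apply: eq_bigr => h _.
by rewrite (sum_Alt3 (fun a b c => kap (g * h^-1)%g (kap h (v a) (v b)) (v c)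
  + kap (g * h^-1)%g (kap h (v a) (v b)) (v c))) /= [RHS]addrACA
  [in RHS](addrACA (kap _ (kap h (v 1) _) _)).
Qed.

Lemma coord_jac g (i j l q : 'I_n) : coord e q (jac g e`_i e`_j e`_l) =
  \sum_h \sum_p (stc h i j p * stc (g * h^-1)%g p l q
    + stc h j l p * stc (g * h^-1)%g p i q + stc h l i p * stc (g * h^-1)%g p j q).
Proof.
have coord2 a b (x y z : 'I_n) : coord e q (kap b (kap a e`_x e`_y) e`_z) =
    \sum_p stc a x y p * stc b p z q.
  rewrite [kap a _ _ in LHS](coord_sumE eB) kap_suml linear_sum; apply: eq_bigr => p _.
  by rewrite linearZ.
rewrite linear_sum; apply: eq_bigr => h _ /=.
by rewrite !linearD /= !coord2 -!big_split; apply: eq_bigr => p _; rewrite /= addrA.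
Qed.

(** In each term the third index d differs from the first two, so e_d is not
    moved by the h of the inner factor; with e_p it is fixed by h, and by the
    weight condition for the outer factor so is e_q.  The outer factor says
    that gh^-1 fixes e_q. *)
Lemma jac_coord_fix g (i j l q : 'I_n) : i != j -> l != i -> l != j ->
  coord e q (jac g e`_i e`_j e`_l) != 0 -> lam g q = 1.
Proof.
move=> ij li lj; rewrite coord_jac => J0; apply/eqP; apply: contraNT J0 => gq.
rewrite big1 // => h _; rewrite big1 // => p _.
have lamg : lam g q = lam (g * h^-1)%g q * lam h q.
  by rewrite -(lamM eB elam) mulgKV.
have term0 (a b d : 'I_n) : d != a -> d != b ->
    stc h a b p * stc (g * h^-1)%g p d q = 0.
  move=> da db; apply/eqP; apply: contraNT gq; rewrite mulf_eq0 negb_or => /andP[c1 c2].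
  have gq1 := stc_fixed c2; have hp1 := stc_fixed c1.
  have hd1 : lam h d = 1.
    by apply/eqP; apply: contraT => /(stc_moved c1); rewrite (negPf da) (negPf db).
  have hq1 : lam h q = 1 by apply: (mulfI c2); rewrite stc_weight hp1 hd1 !mulr1.
  by rewrite lamg gq1 hq1 mulr1.
by rewrite !term0 ?addr0 // 1?eq_sym // 1?eq_sym.
Qed.

(** The projection of V onto V^g along the other eigenspaces of g. *)
Definition fix_proj g (v : V) : V :=
  \sum_p (if lam g p == 1 then coord e p v else 0) *: e`_p.

Fact fix_proj_is_linear g : linear (fix_proj g).
Proof.
move=> a v w; rewrite /fix_proj scaler_sumr -big_split; apply: eq_bigr => p _ /=.
case: ifP => _; last by rewrite !scale0r scaler0 addr0.
by rewrite linearP scalerDl scalerA.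
Qed.
HB.instance Definition _ g :=
  GRing.isLinear.Build k V V _ (fix_proj g) (fix_proj_is_linear g).

Lemma fix_proj_id g v : (forall q, coord e q v != 0 -> lam g q = 1) -> fix_proj g v = v.
Proof.
move=> vg; rewrite [RHS](coord_sumE eB); apply: eq_bigr => p _.
by case: eqP => // gp; have [->//|/vg] := eqVneq (coord e p v) 0.
Qed.

Lemma fix_proj_sub g v : fix_proj g (v - rho g v) = 0.
Proof.
rewrite /fix_proj big1 // => p _; case: eqP => [gp|_]; last by rewrite scale0r.
by rewrite raddfB /= (coord_rho eB elam) gp mul1r subrr scale0r.
Qed.

(** The induced algebra map of S(V), whose kernel is the ideal generated by the
    complement of V^g. *)
Definition fix_quot g : symalg V -> symalg V := symlift (symv \o fix_proj g).
HB.instance Definition _ g := GRing.LRMorphism.on (fix_quot g).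

Lemma fix_quotv g v : fix_quot g (symv v) = symv (fix_proj g v).
Proof. exact: symliftv. Qed.

(** In S#G, v (s g) - (s g) v = s (v - g v) g, and g acts trivially on the
    projection of v - g v, which is 0. *)
Lemma fix_quot_dstar g p (b : cochain rho p) v :
  fix_quot g (skew_fun (dstar b v) g) = 0.
Proof.
rewrite /dstar skew_sumE raddf_sum big1 // => i _ /=.
set x := b _; rewrite skewZE linearZ /= skewDE skewNE.
have -> : skew_fun (symvec_elt rho (v i) * x) g = symv (v i) * skew_fun x g.
  rewrite skewME (bigD1 1%g) //= big1 ?addr0 => [|h h1].
    by rewrite skew_eltE eqxx invg1 mul1g; congr (_ * _); exact: sym_act1.
  by rewrite skew_eltE (negPf h1) mul0r.
have -> : skew_fun (x * symvec_elt rho (v i)) g =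
    skew_fun x g * symv (rho g (v i)).
  rewrite skewME (bigD1 g) //= big1 ?addr0 => [|h hg].
    by rewrite skew_eltE mulVg eqxx; congr (_ * _); exact: sym_actv.
  by rewrite skew_eltE -eq_mulVg1 (negPf hg) raddf0 mulr0.
rewrite [skew_fun x g * _]mulrC -mulrBl -raddfB rmorphM /= fix_quotv fix_proj_sub.
by rewrite raddf0 mul0r scaler0.
Qed.

Hypothesis char2 : 2%N \notin [pchar k].
Hypothesis kL_cob : coboundary (bracket rho kL kL).

Lemma addvv_eq0 (v : V) : v + v = 0 -> v = 0.
Proof.
move=> vv; have : (2%:R : k) *: v == 0 by rewrite scaler_nat mulr2n vv.
by rewrite scaler_eq0 => /orP[c2|/eqP//]; move: char2; rewrite inE /= c2.
Qed.

(** The coefficient of g is both in V^g, where the projection is the identity,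
    and in a coboundary, which the projection kills. *)
Lemma jac_basis g (i j l : 'I_n) : i != j -> l != i -> l != j ->
  jac g e`_i e`_j e`_l = 0.
Proof.
move=> ij li lj; apply: addvv_eq0; apply: symv_inj.
have [b [_ bE]] := kL_cob.
pose v : {ffun 'I_3 -> V} :=
  [ffun a => if a == 0 then e`_i else if a == 1 then e`_j else e`_l].
have [v0 v1 v2] : [/\ v 0 = e`_i, v 1 = e`_j & v 2 = e`_l] by split; rewrite ffunE.
have brE := bracketE v g; rewrite v0 v1 v2 in brE.
rewrite -[in LHS](@fix_proj_id g (_ + _)); last first.
  move=> q; rewrite raddfD /=.
  have [->|J0 _] := eqVneq (coord e q (jac g e`_i e`_j e`_l)) 0.
    by rewrite addr0 eqxx.
  exact: jac_coord_fix J0.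
by rewrite -fix_quotv -brE bE fix_quot_dstar raddf0.
Qed.

(** When two indices agree the three terms cancel because kL alternates. *)
Lemma stc_jacobi g (i j l q : 'I_n) :
  \sum_h \sum_p (stc h i j p * stc (g * h^-1)%g p l q
    + stc h j l p * stc (g * h^-1)%g p i q + stc h l i p * stc (g * h^-1)%g p j q) = 0.
Proof.
have [->|ij] := eqVneq i j.
  rewrite big1 // => h _; rewrite big1 // => p _.
  by rewrite stcxx mul0r add0r (stcC h l j) mulNr addNr.
have [->|li] := eqVneq l i.
  rewrite big1 // => h _; rewrite big1 // => p _.
  by rewrite stcxx mul0r addr0 (stcC h i j) mulNr addrN.
have [->|lj] := eqVneq l j.
  rewrite big1 // => h _; rewrite big1 // => p _.
  by rewrite stcxx mul0r addr0 (stcC h i j) mulNr addrN.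
by rewrite -coord_jac jac_basis // raddf0.
Qed.

Lemma jac_rot g x y z : jac g x y z = jac g y z x.
Proof. by apply: eq_bigr => h _; rewrite addrC addrA. Qed.

(** The Jacobi expression is linear in its first argument, and by rotation in
    each of them. *)
Lemma jac_eq0_basis g y z : (forall i : 'I_n, jac g e`_i y z = 0) -> forall x, jac g x y z = 0.
Proof.
move=> J0 x; transitivity (\sum_i coord e i x *: jac g e`_i y z); last first.
  by rewrite big1 // => i _; rewrite J0 scaler0.
rewrite /jac [x in LHS](coord_sumE eB).
under eq_bigr do rewrite !(kap_suml, kap_sumr) -!big_split /=.
rewrite exchange_big; apply: eq_bigr => i _; rewrite scaler_sumr.
by apply: eq_bigr => h _; rewrite !scalerDr.
Qed.

Theorem jac0 g x y z : jac g x y z = 0.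
Proof.
apply: jac_eq0_basis => i; rewrite jac_rot; apply: jac_eq0_basis => j; rewrite jac_rot.
apply: jac_eq0_basis => l; rewrite [LHS](coord_sumE eB).
by rewrite big1 // => q _; rewrite coord_jac stc_jacobi scale0r.
Qed.

Theorem bracket0 v : bracket rho kL kL v = 0.
Proof. by apply: skewP => g; rewrite bracketE jac0 addr0 raddf0 [RHS]ffunE. Qed.

End StructureConstants.

(** * The corollary *)
Theorem corollary8p2 (k : fieldType) (gT : finGroupType) (V : vectType k)
    (rho : linrep gT V) (kL : {ffun 'I_2 -> V} -> {ffun gT -> V}) :
  2%N \notin [pchar k] ->
  (#|gT|%:R : k) \is a GRing.unit ->
  has_all_eigenvalues rho ->
  abelian [set: gT] ->
  alternating kL ->
  in_H (lin_cochain rho kL) ->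
  G_invariant (lin_cochain rho kL) ->
  cocycle (lin_cochain rho kL) ->
  coboundary (bracket rho kL kL) ->
  (forall v, bracket rho kL kL v = 0) /\
  drinfeld_orbifold_algebra rho (mk_kappa (fun _ => 0) kL).
Proof.
move=> char2 unitG eig abG kL_alt kL_H kL_G _ kL_cob.
have [e [lam [eB elam]]] := eigenbasis_exists unitG eig abG.
have jacobi := stc_jacobi eB elam kL_alt kL_H kL_G abG char2 kL_cob.
split; first exact: (bracket0 eB elam kL_alt kL_H kL_G abG char2 kL_cob).
apply: drinfeld_of_symbol => d x Fx Ix.
apply: (symbol_size abG eB elam (c := stc e kL) _ _ _ _ _ _ Fx Ix).
- by move=> g i j p; exact: stcC.
- by move=> g i p; exact: stcxx.
- by move=> g h i j p; exact: stc_weight.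
- by move=> g i j l p; exact: stc_fix_other.
(* The operators use the structure constants with the two lower indices of the
   outer factor exchanged, which changes the sign. *)
- move=> i j l _ _ _ g q; apply/eqP; rewrite -oppr_eq0 -sumrN; apply/eqP.
  rewrite -[RHS](jacobi g i j l q); apply: eq_bigr => h _.
  rewrite -sumrN; apply: eq_bigr => p _; rewrite !opprD -!mulrN.
  by rewrite -!(stcC e kL_alt).
- by move=> v w g p; exact: coord_kap.
Qed.
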